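(* Let $Q\in\mathcal B$. Then the function $(0,1)\ni\alpha\mapsto\mathcal H^{\alpha,0}(\Lambda,\phi_0)(Q)$ is right differentiable, and $$\left.\frac{d_+}{d_+\alpha}\mathcal H^{\alpha,0}(\Lambda,\phi_0)(Q)\right|_{\alpha=\alpha_0}=\Psi^{\alpha_0,\alpha_0}_1(Q)=\lim_{\alpha\to\alpha_0,\ \alpha>\alpha_0}\Psi^{\alpha,\alpha}_1(Q)$$ for all $0<\alpha_0<1$, where $d_+/d_+\alpha$ denotes the right derivative. From the left, for every $0<\alpha<1$ and $\tau>0$, $$\lim_{\alpha_0\to\alpha,\ \alpha_0<\alpha}\Psi^{\alpha_0,\alpha_0}_{1,\epsilon_\tau(\alpha_0,\alpha)}(Q)=\lim_{\alpha_0\to\alpha,\ \alpha_0<\alpha}\Psi^{\alpha,\alpha_0}_{1,\epsilon_\tau(\alpha_0,\alpha)}(Q)=\Psi^{\alpha,\alpha}_1(Q),$$ and, for every $0<\alpha<1$ and $\tau>1$, $$\Psi^{\alpha,\alpha}_1(Q)\le\liminf_{\alpha_0\to\alpha,\ \alpha_0<\alpha}\frac{\mathcal H^{\alpha_0,0}(\Lambda,\phi_0)(Q)-\mathcal H^{\alpha,0}(\Lambda,\phi_0)(Q)}{\alpha_0-\alpha}\le\liminf_{\alpha_0\to\alpha,\ \alpha_0<\alpha}\Psi^{\alpha,\alpha_0}_{1,\delta_\tau(\alpha_0,\alpha)}(Q)=\liminf_{\alpha_0\to\alpha,\ \alpha_0<\alpha}\Psi^{\alpha_0,\alpha_0}_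{1,\delta_\tau(\alpha_0,\alpha)}(Q).$$
   Context: Setting. Let $X$ be a set, $S:X\to X$ a bijection, $\mathcal A$ a $\sigma$-algebra on $X$, $\mathcal A_0$ the $\sigma$-algebra generated by $\bigcup_{i\ge 0}S^{-i}\mathcal A$, $\mathcal B$ the $\sigma$-algebra generated by $\bigcup_{i\in\mathbb Z}S^{-i}\mathcal A$, and $\mathcal A_m:=S^{-m}\mathcal A_0=\{S^{-m}A:A\in\mathcal A_0\}$ for integers $m\le 0$ (so $\mathcal A_0\subset\mathcal A_{-1}\subset\cdots$). Let $\phi_0$ be a finite positive measure on $\mathcal A_0$, and $\Lambda$ a finite positive measure on $\mathcal A_0$ with $\Lambda\circ S^{-1}=\Lambda$ and $\Lambda\ll\phi_0$; let $Z\ge0$ be an $\mathcal A_0$-measurable version of $d\Lambda/d\phi_0$. For $Q\subset X$ let $\mathcal C(Q)$ be the set of all sequences $(A_m)_{m\le0}$ with $A_m\in\mathcal A_m$ for all $m\le 0$ and $Q\subset\bigcup_{m\le0}A_m$. Define $\Phi(Q):=\inf_{(A_m)\in\mathcal C(Q)}\sum_{m\le0}\phi_0(S^mA_m)$. Conventions: extended real numbers are used, $0\log0:=0$, $y^x:=e^{x\log y}$ and thus $0^0:=1$; $Z^\alpha\log Z:=0$ where $Z=0$ ($\alpha>0$). For $\epsilon>0$ and $\alpha\in[0,1]$: $\mathcal C^0_\epsilon(Q):=\{(A_m)\in\mathcal C(Q):\sum_{m\le0}\phi_0(S^mA_m)<\Phi(Q)+\epsilon\}$; $\mathcal H^{\alpha,0}_\epsilon(\Lambda,\phi_0)(Q):=\inf_{(A_m)\in\mathcal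 C^0_\epsilon(Q)}\sum_{m\le0}\int_{S^mA_m}Z^\alpha d\phi_0$; $\mathcal H^{\alpha,0}(\Lambda,\phi_0)(Q):=\lim_{\epsilon\to0}\mathcal H^{\alpha,0}_\epsilon(\Lambda,\phi_0)(Q)$, which is a finite $S$-invariant measure on $\mathcal B$. For $Q\in\mathcal B$: $\mathcal C^{\alpha}_{1,\epsilon}(Q):=\{(A_m)\in\mathcal C^0_\epsilon(Q):\sum_{m\le0}\int_{S^mA_m}Z^\alpha d\phi_0<\mathcal H^{\alpha,0}(\Lambda,\phi_0)(Q)+\epsilon\}$; for $0<\alpha\le1$, $0\le\alpha_0\le1$: $\Psi^{\alpha,\alpha_0}_{1,\epsilon}(Q):=\inf_{(A_m)\in\mathcal C^{\alpha_0}_{1,\epsilon}(Q)}\sum_{m\le0}\int_{S^mA_m}Z^\alpha\log Z\,d\phi_0$ and $\Psi^{\alpha,\alpha_0}_1(Q):=\lim_{\epsilon\to0}\Psi^{\alpha,\alpha_0}_{1,\epsilon}(Q)$. For $\tau>0$ and $\alpha_1,\alpha_2\in[0,1]$ (with $Q$ fixed): $\delta_\tau(\alpha_1,\alpha_2):=|\alpha_1-\alpha_2|^{\tau/2}\sup\{0<\delta<|\alpha_1-\alpha_2|^{\tau/2}:\ \mathcal H^{\alpha_i,0}_\delta(\Lambda,\phi_0)(Q)>\mathcal H^{\alpha_i,0}(\Lambda,\phi_0)(Q)-|\alpha_1-\alpha_2|^\tau\text{ for }i=1,2\}$. For $0<\alpha_0\le\alpha<1$: $\epsilon_\tau(\alpha_0,\alpha):=(\alpha-\alpha_0)\big(\Psi^{\alpha,\alpha_0}_{1,\delta_\tau(\alpha_0,\alpha)}(Q)-\Psi^{\alpha_0,\alpha}_{1,\delta_\tau(\alpha_0,\alpha)}(Q)\big)+2(\alpha-\alpha_0)^\tau+3\delta_\tau(\alpha_0,\alpha)$.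 *)

(* Defs.v *)
From HB Require Import structures.
From mathcomp Require Import all_boot all_order all_algebra.
From mathcomp Require Import all_classical all_reals all_analysis.
From mathcomp Require Import measurable_realfun.

Set Implicit Arguments.
Unset Strict Implicit.
Unset Printing Implicit Defensive.

Import Order.TTheory GRing.Theory Num.Theory.
Import numFieldNormedType.Exports.

Local Open Scope classical_set_scope.
Local Open Scope ring_scope.
Local Open Scope ereal_scope.

Section shifted_sigma_algebras.
Context {X : pointedType} (S : X -> X) (AA : set (set X)).

(* S^k B for an integer k; this is the integer action of S on sets when S is
   bijective. *)
Definition zimage (k : int) (B : set X) : set X :=
  match k with
  | Posz n => iter n S @` B
  | Negz n => iter n.+1 S @^-1` B
  end.

Definition gen0 : set (set X) :=
  \bigcup_(i in [set: nat]) (zimage (- i%:Z) @` AA).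

Definition genZ : set (set X) :=
  \bigcup_(i in [set: int]) (zimage (- i) @` AA).

Definition sigma_at (m : int) : set (set X) := zimage (- m) @` <<s gen0 >>.

(* A family (A_m)_{m <= 0} is encoded as the sequence n |-> A_{-n}. *)
Definition covers (Q : set X) : set ((set X)^nat) :=
  [set A | (forall n, sigma_at (- n%:Z) (A n)) /\ Q `<=` \bigcup_n A n].

(* S^m A_m for m = -n *)
Definition pull (A : (set X)^nat) (n : nat) : set X :=
  zimage (- n%:Z) (A n).

End shifted_sigma_algebras.

(* X with the sigma-algebra A_0 = <<s gen0 S AA >> *)
Notation space0 S AA := (g_sigma_algebraType (gen0 S AA)).

Section cover_functionals.
Context {R : realType} {X : pointedType} (S : X -> X) (AA : set (set X)).
Variables (phi0 : {finite_measure set (space0 S AA) -> \bar R}).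
Variables (Z : space0 S AA -> \bar R) (Q : set X).
Implicit Types (eps : \bar R) (alpha tau : R) (A : (set X)^nat).

Definition mass A : \bar R := \sum_(0 <= n <oo) phi0 (pull S A n).

Definition Phi : \bar R := ereal_inf [set mass A | A in covers S AA Q].

Definition pow_sum alpha A : \bar R :=
  \sum_(0 <= n <oo) \int[phi0]_(x in pull S A n) (Z x `^ alpha).

(* For alpha > 0 the integrand vanishes where Z = 0, because 0 `^ alpha = 0,
   lne 0 = -oo and 0 * -oo = 0.  It is bounded below by -1 / (e alpha), so the
   negative parts of the terms are summable as soon as mass A is finite, and
   the partial sums then converge in \bar R. *)
Definition powlog_sum alpha A : \bar R :=
  \sum_(0 <= n <oo) \int[phi0]_(x in pull S A n) (Z x `^ alpha * lne (Z x)).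

Definition covers0 eps : set ((set X)^nat) :=
  [set A | covers S AA Q A /\ mass A < Phi + eps].

Definition Heps alpha eps : \bar R :=
  ereal_inf [set pow_sum alpha A | A in covers0 eps].

(* Heps alpha is nonincreasing in eps, so this limit exists in \bar R; the same
   holds for Psi1 below. *)
Definition Hlim alpha : \bar R := lim (Heps alpha e%:E @[e --> (0%R : R)^'+]).

Definition covers1 alpha eps : set ((set X)^nat) :=
  [set A | covers0 eps A /\ pow_sum alpha A < Hlim alpha + eps].

Definition Psi1eps alpha alpha0 eps : \bar R :=
  ereal_inf [set powlog_sum alpha A | A in covers1 alpha0 eps].

Definition Psi1 alpha alpha0 : \bar R :=
  lim (Psi1eps alpha alpha0 e%:E @[e --> (0%R : R)^'+]).

Definition delta tau alpha1 alpha2 : R :=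
  let r := (`|alpha1 - alpha2| `^ (tau / 2))%R in
  let t := (`|alpha1 - alpha2| `^ tau)%R in
  (r * sup [set d : R | (0 < d < r)%R /\
              (Hlim alpha1 - t%:E < Heps alpha1 d%:E)%E /\
              (Hlim alpha2 - t%:E < Heps alpha2 d%:E)%E])%R.

Definition eps_tau tau alpha0 alpha : \bar R :=
  let d := delta tau alpha0 alpha in
  (alpha - alpha0)%:E * (Psi1eps alpha alpha0 d%:E - Psi1eps alpha0 alpha d%:E)
  + (2 * (alpha - alpha0) `^ tau)%:E + (3 * d)%:E.

End cover_functionals.

Section one_sided_derivative.
Context {R : realType}.
Implicit Types (f : R -> \bar R) (a b : R).

Definition diff_quot f a b : \bar R := (f b - f a) * ((b - a)^-1)%:E.

(* A finite limit forces f to be finite at a and at all points right of, and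
   close enough to, a (+oo - +oo is -oo). *)
Definition right_derivable f a : Prop :=
  exists l : R, diff_quot f a b @[b --> a^'+] --> l%:E.

Definition right_derive f a : \bar R := lim (diff_quot f a b @[b --> a^'+]).

End one_sided_derivative.

(* Main.v *)
(** For a cover A, let nu_A be the law of Z under the sum of the restrictions of
    phi0 to the sets S^m A_m; then pow_sum alpha A is the integral of z^alpha
    against nu_A, and powlog_sum alpha A is its derivative in alpha.  Replacing
    A_m by A_m minus the A_k with m < k <= 0 lowers the mass and pow_sum, raises
    powlog_sum by at most 1/alpha times the removed mass, and bounds the first
    moment of nu_A by Lambda(X), because Lambda is S-invariant.  On such covers
    alpha |-> pow_sum alpha A is convex, with a derivative which is bounded and
    Lipschitz on compact subintervals of (0,1), uniformly in A.  The statement is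
    then Danskin's theorem on the one-sided derivatives of an infimum of functions:
    a cover that is nearly optimal at s is nearly optimal at every t close to s,
    and along such covers H is squeezed between tangent lines of slopes
    powlog_sum s A and powlog_sum t A. *)

Require Import Defs.
From HB Require Import structures.
From mathcomp Require Import all_boot all_order all_algebra.
From mathcomp Require Import all_classical all_reals all_analysis.
From mathcomp Require Import measurable_realfun.
From mathcomp Require Import ring lra.

Set Implicit Arguments.
Unset Strict Implicit.
Unset Printing Implicit Defensive.

Import Order.TTheory GRing.Theory Num.Theory.
Import numFieldNormedType.Exports.

Local Open Scope classical_set_scope.
Local Open Scope ring_scope.
Local Open Scope ereal_scope.

(** * Pointwise bounds for x^a and x^a ln x *)

Section powR_ln_bounds.
Context {R : realType}.
Implicit Types a b s t x y : R.
Local Open Scope ring_scope.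

(** The infima need not be attained, so near-optimality is tracked by an explicit radius. The mass
    constraint does not involve the exponent, hence one cover competes at every exponent; only its
    excess has to be followed. All constants are uniform on an interval [a, 1 - a] only: bounding
    |x^s ln x| by a multiple of 1 + x needs s > 0 near x = 0 and s < 1 at infinity. The two sides
    behave differently because near-optimal covers give lower semicontinuity of Psi and nothing
    more. To the right of t, the slope of H between t and s lies between Psi(s) and Psi(t) up to O(s
    - t), and semicontinuity closes this sandwich. To the left it lies between Psi(t) and Psi(s),
    and no upper bound of Psi(s) by Psi(t) is at hand. The left limits are recovered by the radius
    eps_tau, which dominates the excess at s of covers near-optimal at t and so admits them as
    competitors. With delta_tau one keeps only an upper estimate of the slope, with an error of
    order (t - s)^(tau - 1), which vanishes for tau > 1. *)

Lemma sqr_le_expR (s : R) : 0 <= s -> s ^+ 2 <= 4 * expR s.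
Proof.
move=> s0; have h : 1 + s / 2 <= expR (s / 2) by exact: expR_ge1Dx.
have -> : expR s = expR (s / 2) ^+ 2 by rewrite -expRM_natl; congr expR; lra.
nra.
Qed.

(** For x = e^t this controls the second derivative x^s (ln x)^2 of s |-> x^s by the weight 1 + x.
    The factor t^2 is absorbed by a spare exponential: e^((1 - s) t) for t >= 0, e^(- s t) for t <
    0, both with rate at least a. *)
Lemma sqr_expR_le (a s t : R) : 0 < a -> a <= s -> s <= 1 - a ->
  t ^+ 2 * expR (s * t) <= 4 / a ^+ 2 * (1 + expR t).
Proof.
move=> a0 as_ sa.
have aux u r : a <= r -> 0 <= u -> u ^+ 2 * a ^+ 2 <= 4 * expR (r * u).
  move=> ar u0; apply: (le_trans _ (sqr_le_expR _)); last by rewrite mulr_ge0 //; lra.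
  rewrite -exprMn ler_sqr ?nnegrE ?mulr_ge0//; [nra|lra|lra].
have a20 : 0 < a ^+ 2 by rewrite exprn_gt0.
have et := expR_gt0 t.
rewrite [leRHS]mulrAC ler_pdivlMr//.
have [t0|t0] := leP 0 t.
- have := aux t (1 - s) ltac:(lra) t0 => h.
  have -> : expR t = expR ((1 - s) * t) * expR (s * t).
    by rewrite -expRD; congr expR; ring.
  have := expR_gt0 (s * t) => e0; nra.
- have := aux (- t) s ltac:(lra) ltac:(lra) => h.
  have e1 : expR (s * - t) * expR (s * t) = 1.
    by rewrite -expRD -[RHS]expR0; congr expR; ring.
  have := expR_gt0 (s * t) => e0.
  have : t ^+ 2 * a ^+ 2 * expR (s * t) <= 4 * (expR (s * - t) * expR (s * t)).
    have -> : 4 * (expR (s * - t) * expR (s * t)) =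
              4 * expR (s * - t) * expR (s * t) by ring.
    by apply: ler_wpM2r; [exact: ltW|rewrite -(sqrrN t)].
  rewrite e1; nra.
Qed.

(* Convexity of [a |-> x `^ a]; at [x = 0] both sides vanish. *)
Lemma powR_tangent_le x a b : 0 <= x -> 0 < a -> 0 < b ->
  (b - a) * (x `^ a * ln x) <= x `^ b - x `^ a.
Proof.
rewrite le_eqVlt => /predU1P[<- a0 b0|x0 _ _].
  by rewrite !powR0 ?gt_eqF// !mul0r mulr0 subrr.
rewrite /powR gt_eqF//.
have -> : b * ln x = (b - a) * ln x + a * ln x by ring.
rewrite expRD; have := expR_ge1Dx ((b - a) * ln x); have := expR_gt0 (a * ln x).
nra.
Qed.

Lemma powR_le1D x a : 0 <= x -> 0 <= a <= 1 -> x `^ a <= 1 + x.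
Proof.
move=> x0 /andP[a0 a1]; have [x1|x1] := leP 1 x.
  by apply: (le_trans (ler1_powR x1 a1)); lra.
move: x0; rewrite le_eqVlt => /predU1P[<-|x0].
  by rewrite addr0 /powR eqxx; case: eqP.
have x01 : 0 < x <= 1 by rewrite x0 ltW.
have := ger_powR x01 a0; rewrite powRr0; lra.
Qed.

(** With u = a ln x this is u e^u >= -1, which follows from 1 - u <= e^(-u). *)
Lemma powR_ln_ge x a : 0 <= x -> 0 < a -> - a^-1 <= x `^ a * ln x.
Proof.
rewrite le_eqVlt => /predU1P[<- a0|x0 a0].
  by rewrite powR0 ?gt_eqF// mul0r oppr_le0 invr_ge0 ltW.
rewrite /powR gt_eqF// -div1r -mulNr ler_pdivrMr//.
set u := a * ln x; have -> : expR u * ln x * a = expR u * u by rewrite /u; ring.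
have := expR_ge1Dx (- u); rewrite expRN.
have e0 := expR_gt0 u; move=> h.
have : expR u * (1 - u) <= expR u * (expR u)^-1 by rewrite ler_wpM2l// ltW.
rewrite mulfV ?gt_eqF//; nra.
Qed.

(** With u = (1 - b) ln x one has x = x^b e^u, and the claim reduces to u <= e^u. *)
Lemma powR_ln_le x b : 0 <= x -> b < 1 -> 0 < b ->
  x `^ b * ln x <= (1 - b)^-1 * x.
Proof.
rewrite le_eqVlt => /predU1P[<- b1 b0|x0 b1 b0].
  by rewrite powR0 ?gt_eqF// mul0r mulr0.
rewrite [leRHS]mulrC ler_pdivlMr ?subr_gt0//.
rewrite /powR gt_eqF// -mulrA (mulrC (ln x)).
set u := (1 - b) * ln x.
have := expR_ge1Dx u => h.
have e0 := expR_gt0 (b * ln x).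
have xE : x = expR (b * ln x) * expR u.
  by rewrite -expRD /u -[LHS]lnK ?posrE//; congr expR; ring.
rewrite [leRHS]xE ler_wpM2l// ?ltW//; lra.
Qed.

Lemma norm_powR_ln_le x a s : 0 <= x -> 0 < a -> a <= s -> s <= 1 - a ->
  `|x `^ s * ln x| <= a^-1 * (1 + x).
Proof.
move=> x0 a0 as_ sa.
have s0 : 0 < s by lra.
have s1 : s < 1 by lra.
have i1 : s^-1 <= a^-1 by rewrite lef_pV2// posrE.
have i2 : (1 - s)^-1 <= a^-1 by rewrite lef_pV2// ?posrE; lra.
have ia : 0 < a^-1 by rewrite invr_gt0.
have := powR_ln_le x0 s1 s0; have := powR_ln_ge x0 s0.
rewrite ler_norml => h1 h2; apply/andP; split; nra.
Qed.

Lemma powR_ln_lip x a s t : 0 <= x -> 0 < a ->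
  a <= s -> s <= 1 - a -> a <= t -> t <= 1 - a ->
  `|x `^ t * ln x - x `^ s * ln x| <= 8 / a ^+ 2 * `|t - s| * (1 + x).
Proof.
move=> x0 a0 as_ sa at_ ta.
wlog st : s t as_ sa at_ ta / s <= t.
  move=> wl; have [st|/ltW ts] := leP s t; first exact: wl.
  by rewrite distrC (distrC t); exact: wl.
move: x0; rewrite le_eqVlt => /predU1P[<-|x0].
  rewrite !powR0; try (by rewrite gt_eqF//; lra).
  rewrite !mul0r subrr normr0 addr0 mulr1 mulr_ge0// divr_ge0//.
  by rewrite exprn_ge0// ltW.
rewrite /powR gt_eqF//; set u := ln x.
have xE : x = expR u by rewrite /u lnK ?posrE.
rewrite -mulrBl normrM (ger0_norm (_ : 0 <= t - s)) ?subr_ge0//.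
(* The tangent lines of the exponential at both endpoints replace the mean value theorem. One more
   factor |u| then produces u^2 at both endpoints, where [sqr_expR_le] applies twice; hence 8 = 4 +
   4. *)
have d1 : `|expR (t * u) - expR (s * u)| <=
    (t - s) * `|u| * (expR (t * u) + expR (s * u)).
  have tE : expR (t * u) * expR ((s - t) * u) = expR (s * u).
    by rewrite -expRD; congr expR; ring.
  have sE : expR (s * u) * expR ((t - s) * u) = expR (t * u).
    by rewrite -expRD; congr expR; ring.
  have h1 := expR_ge1Dx ((s - t) * u); have h2 := expR_ge1Dx ((t - s) * u).
  have e1 := expR_gt0 (t * u); have e2 := expR_gt0 (s * u).
  have l1 : expR (t * u) * (1 + (s - t) * u) <= expR (s * u).
    by rewrite -tE ler_wpM2l// ltW.
  have l2 : expR (s * u) * (1 + (t - s) * u) <= expR (t * u).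
    by rewrite -sE ler_wpM2l// ltW.
  have n1 := ler_norm u; have := ler_norm (- u); rewrite normrN => n2.
  have n0 := normr_ge0 u.
  have st0 : 0 <= t - s by rewrite subr_ge0.
  have m1 : (t - s) * u <= (t - s) * `|u| by rewrite ler_wpM2l.
  have m2 : (t - s) * - u <= (t - s) * `|u| by rewrite ler_wpM2l.
  have m0 : 0 <= (t - s) * `|u| by rewrite mulr_ge0.
  set w := (t - s) * `|u| in m0 m1 m2 *.
  rewrite ler_norml; apply/andP; split; nra.
have k1 := @sqr_expR_le a t u a0 at_ ta; have k2 := @sqr_expR_le a s u a0 as_ sa.
apply: (le_trans (ler_wpM2r (normr_ge0 u) d1)).
have -> : (t - s) * `|u| * (expR (t * u) + expR (s * u)) * `|u| =
  (t - s) * (u ^+ 2 * expR (t * u) + u ^+ 2 * expR (s * u)).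
  by rewrite -[u ^+ 2]real_normK ?num_real//; ring.
have -> : 8 / a ^+ 2 * (t - s) * (1 + x) =
   (t - s) * (4 / a ^+ 2 * (1 + expR u) + 4 / a ^+ 2 * (1 + expR u)).
  by rewrite -xE; lra.
by rewrite ler_wpM2l ?subr_ge0// lerD.
Qed.

End powR_ln_bounds.

(** * Disjoint covers *)

Section disjoint_covers.
Context {X : pointedType} (S : X -> X) (AA : set (set X)).
Hypothesis S_inj : injective S.
Local Notation T := (space0 S AA).
Implicit Types (A : (set X)^nat) (B : (set T)^nat) (Q : set X).

Lemma iter_inj n : injective (iter n S).
Proof. by elim: n => // n IH x y /= /S_inj /IH. Qed.

Lemma zimage_neg_preimage n (B : set X) :
  zimage S (- n%:Z) B = iter n S @^-1` B.
Proof. by case: n => // ; rewrite /= image_id. Qed.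

Lemma preimage_iter_image n (B : set X) : iter n S @^-1` (iter n S @` B) = B.
Proof.
apply/seteqP; split => x /=; last by exists x.
by move=> [y By /iter_inj <-].
Qed.

(** Pulling back by S turns the generator of index i into that of index i + 1, so the family of
    generators is stable. *)
Lemma measurable_shift : measurable_fun [set: T] (S : T -> T).
Proof.
have mgen (C : set X) : gen0 S AA C -> gen0 S AA (S @^-1` C).
  move=> [i _ [a Aa <-]]; exists i.+1 => //; exists a => //.
  by rewrite !zimage_neg_preimage; apply: funext => x /=; rewrite -iterSr.
apply: (@measurability _ _ T T setT S (gen0 S AA)) => // C [D gD <-].
by rewrite setTI; apply: sub_sigma_algebra; exact: mgen.
Qed.

Lemma measurable_iter_preimage n (B : set T) :
  measurable B -> measurable (iter n S @^-1` B : set T).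
Proof.
elim: n B => // n IH B mB.
have := measurable_shift measurableT mB; rewrite setTI => /IH.
by congr measurable.
Qed.

(** Covers are parametrized by their pullbacks: B is a sequence of sets of the fixed sigma-algebra
    A_0, and the functionals [mass], [pow_sum] and [powlog_sum] see a cover only through it. *)
Definition iter_cover (B : (set X)^nat) : (set X)^nat := fun n => iter n S @` B n.

Lemma pull_iter_cover B : pull S (iter_cover B) = B.
Proof.
by apply: funext => n; rewrite /pull zimage_neg_preimage preimage_iter_image.
Qed.

Lemma covers_iter_cover B Q : (forall n, measurable (B n)) ->
  Q `<=` \bigcup_n (iter n S @` B n) -> covers S AA Q (iter_cover B).
Proof.
move=> mB QB; split=> // n; exists (B n); first exact: mB.
by rewrite opprK.
Qed.

Lemma coversP A Q : covers S AA Q A ->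
  (forall n, measurable (pull S A n : set T)) /\ A = iter_cover (pull S A).
Proof.
move=> [Am _]; have AE n : exists2 B : set T, measurable B & A n = iter n S @` B.
  by have [B mB <-] := Am n; exists B => //; rewrite opprK.
split=> [n|].
  have [B mB AB] := AE n.
  by rewrite /pull zimage_neg_preimage AB preimage_iter_image.
apply: funext => n; have [B mB AB] := AE n.
by rewrite /iter_cover /pull zimage_neg_preimage AB preimage_iter_image.
Qed.

(* With [B = pull S A], this is the pullback under [S^n] of [A_n] minus the
   union of the [A_k] with [k < n]. *)
Definition disj (B : (set X)^nat) : (set X)^nat := fun n =>
  B n `\` \bigcup_(k in `I_n) (iter (n - k) S @^-1` B k).

Lemma disj_sub B n : disj B n `<=` B n.
Proof. by move=> x []. Qed.

Lemma measurable_disj B : (forall n, measurable (B n)) ->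
  forall n, measurable (disj B n : set T).
Proof.
move=> mB n; apply: measurableD => //; apply: bigcup_measurable => k _.
exact: measurable_iter_preimage.
Qed.

Lemma iter_subK n k x : (k <= n)%N -> iter k S (iter (n - k) S x) = iter n S x.
Proof. by move=> kn; rewrite -iterD subnKC. Qed.

Lemma bigcup_disj B :
  \bigcup_n (iter n S @` B n) `<=` \bigcup_n (iter n S @` disj B n).
Proof.
move=> x [n0 _ Bx].
have ex : exists n, `[< (iter n S @` B n) x >] by exists n0; apply/asboolP.
(* A point goes to the first set that contains it; membership in an earlier [B k], shifted by n - k,
   would contradict minimality. *)
case: (ex_minnP ex) => n /asboolP [y By yx] nmin.
exists n => //; exists y => //; split=> // -[k /= kn Bk].
have := nmin k; rewrite leqNgt kn => /(_ _)/negP; apply => //.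
by apply/asboolP; exists (iter (n - k) S y) => //; rewrite iter_subK// ltnW.
Qed.

Lemma covers_disj A Q : covers S AA Q A ->
  covers S AA Q (iter_cover (disj (pull S A))).
Proof.
move=> cA; have [mA AE] := coversP cA.
apply: covers_iter_cover; first exact: measurable_disj.
apply: subset_trans (@bigcup_disj _) => x; case: cA => _ QA /QA.
by rewrite {1}AE.
Qed.

(** The disjoint sets S^k D_k lie in A_(-k), where Lambda need not be defined. Pulling all those
    with k <= n back by the common power S^n puts them into A_0 and keeps them disjoint. *)
Lemma trivIset_disj B n :
  trivIset `I_n.+1 (fun k => iter (n - k) S @^-1` disj B k).
Proof.
apply/trivIsetP => i j /= ilt jlt ij; wlog ij' : i j ilt jlt ij / (i < j)%N.
  move=> wl; have [lt|lt|E] := ltngtP i j; first exact: wl.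
    by rewrite setIC; apply: wl; rewrite // eq_sym.
  by rewrite E eqxx in ij.
rewrite -subset0 => x [/= [Bi _] [_]]; apply; exists i => //=.
by rewrite -iterD addnBAC 1?ltnW// subnKC.
Qed.

Lemma invariant_iter {R : realType} (Lambda : {measure set T -> \bar R})
  (Linv : forall A : set T, measurable A -> Lambda (S @^-1` A) = Lambda A)
  n (A : set T) : measurable A -> Lambda (iter n S @^-1` A) = Lambda A.
Proof.
elim: n A => // n IH A mA.
rewrite -[RHS]Linv// -(IH (S @^-1` A)) //.
by rewrite -[X in measurable X]setTI; exact: measurable_shift.
Qed.

Lemma nneseries_disj_le {R : realType} (Lambda : {measure set T -> \bar R})
  (Linv : forall A : set T, measurable A -> Lambda (S @^-1` A) = Lambda A) B :
  (forall n, measurable (B n)) ->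
  \sum_(0 <= n <oo) Lambda (disj B n) <= Lambda setT.
Proof.
move=> mB; have mD := measurable_disj mB.
apply: lime_le; first by apply: is_cvg_nneseries.
apply: nearW => n; case: n => [|n]; first by rewrite big_geq.
(* Invariance of Lambda moves every term of the partial sum to the common time n, where the sets are
   disjoint parts of X. *)
rewrite (eq_big_nat _ _
  (F2 := fun k => Lambda (iter (n - k) S @^-1` disj B k))); last first.
  by move=> k _; rewrite invariant_iter.
have mP k : measurable (iter (n - k) S @^-1` disj B k : set T).
  exact: measurable_iter_preimage.
have mU : measurable
    (\big[setU/set0]_(k < n.+1) (iter (n - k) S @^-1` disj B k) : set T).
  exact: bigsetU_measurable.
rewrite big_mkord -(@measure_semi_additive_ord_I _ _ _ Lambda
  (fun k => iter (n - k) S @^-1` disj B k) n.+1)//.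
- by apply: le_measure; rewrite ?inE.
- exact: trivIset_disj.
Qed.

End disjoint_covers.

(** * Sums of integrals along a sequence of sets *)

Section sum_integrals.
Context {R : realType} d (T : measurableType d).
Variables (mu nu : {finite_measure set T -> \bar R}) (Z : T -> \bar R).
Hypothesis Z_meas : measurable_fun setT Z.
Hypothesis Z_ge0 : forall x, 0 <= Z x.
Hypothesis Z_density : forall A : set T,
  measurable A -> nu A = \int[mu]_(x in A) Z x.
Implicit Types (f g : T -> R) (B : (set T)^nat).

(** The density may be +oo, but only on a [mu]-null set since [nu] is finite; [fine] puts 0 there,
    and no integral changes. *)
Definition dens (x : T) : R := fine (Z x).

Lemma dens_ge0 x : (0 <= dens x)%R.
Proof. by rewrite fine_ge0. Qed.

Lemma measurable_dens : measurable_fun setT dens.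
Proof. exact: measurableT_comp. Qed.

Lemma Z_integrable : mu.-integrable setT Z.
Proof.
apply/integrableP; split=> //; under eq_integral do rewrite gee0_abs//.
by rewrite -Z_density// fin_num_fun_lty//; exact: fin_num_measure.
Qed.

Lemma ae_Z_dens : {ae mu, forall x, Z x = (dens x)%:E}.
Proof.
apply: filterS (integrable_ae measurableT Z_integrable) => x /(_ I) Zx.
by rewrite /dens fineK.
Qed.

Lemma integral_dens A : measurable A -> \int[mu]_(x in A) (dens x)%:E = nu A.
Proof.
move=> mA; rewrite Z_density//; apply: ge0_ae_eq_integral => //.
- by apply/measurable_EFinP/measurable_funTS; exact: measurable_dens.
- exact: measurable_funTS.
- by move=> x _; rewrite lee_fin dens_ge0.
- by apply: filterS ae_Z_dens => x /= -> .
Qed.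

Lemma integral_poweR A (a : R) : measurable A ->
  \int[mu]_(x in A) (Z x `^ a) = \int[mu]_(x in A) (dens x `^ a)%:E.
Proof.
move=> mA; apply: ae_eq_integral => //.
- apply: measurable_funTS.
  exact: (measurableT_comp (measurable_poweR _)).
- apply/measurable_EFinP/measurable_funTS.
  by apply: (measurableT_comp (measurable_powR _ )); exact: measurable_dens.
- by apply: filterS ae_Z_dens => x /= -> .
Qed.

Definition powln (a : R) (x : T) : R := (dens x `^ a * ln (dens x))%R.

Lemma measurable_powln a : measurable_fun setT (powln a).
Proof.
apply: measurable_funM.
  by apply: (measurableT_comp (measurable_powR _)); exact: measurable_dens.
by apply: (measurableT_comp (@measurable_ln _)); exact: measurable_dens.
Qed.

(** The conventions agree where Z = 0: there 0 * -oo = 0 on the left, and 0^a = 0 annihilates [ln 0]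
    on the right. The two integrands thus differ on the null set Z = +oo only. *)
Lemma poweR_lneE (a : R) x : (0 < a)%R ->
  Z x `^ a * lne (Z x) = if Z x == +oo then +oo else (powln a x)%:E.
Proof.
move=> a0; rewrite /powln /dens; have := Z_ge0 x.
case: (Z x) => [r r0| _|//]; last by rewrite poweRyr //; apply: lt0r_neq0.
move: r0; rewrite lee_fin le_eqVlt => /predU1P[<-|r0].
  by rewrite poweR_EFin /= powR0 ?lt0r_neq0// mul0r mul0e.
by rewrite lne_EFin// poweR_EFin.
Qed.

Lemma integral_poweR_lne A (a : R) : measurable A -> (0 < a)%R ->
  \int[mu]_(x in A) (Z x `^ a * lne (Z x)) = \int[mu]_(x in A) (powln a x)%:E.
Proof.
move=> mA a0; under eq_integral do rewrite poweR_lneE//.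
apply: ae_eq_integral => //.
- apply: measurable_funTS; apply: measurable_fun_ifT => //.
    by apply: measurable_fun_eqe.
  by apply/measurable_EFinP; exact: measurable_powln.
- apply/measurable_EFinP/measurable_funTS; exact: measurable_powln.
- by apply: filterS ae_Z_dens => x /= -> .
Qed.

(** The integrals of 1 + Z along a cover add up to its mass plus its first moment, both bounded
    uniformly on the covers of interest. A pointwise bound by this weight therefore becomes a bound
    uniform in the cover. *)
Definition dominated f := measurable_fun setT f /\
  exists C : R, forall x, (`|f x| <= C * (1 + dens x))%R.

Lemma dominated_integrable f A : measurable A -> dominated f ->
  mu.-integrable A (EFin \o f).
Proof.
move=> mA [mf [C fC]].
have i1 : mu.-integrable setT (EFin \o (fun x => C * (1 + dens x))%R).
  have id : mu.-integrable setT (EFin \o dens).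
    apply/integrableP; split; first by apply/measurable_EFinP; exact: measurable_dens.
    under eq_integral do rewrite gee0_abs ?lee_fin ?dens_ge0//.
    by rewrite integral_dens// fin_num_fun_lty//; exact: fin_num_measure.
  have ic : mu.-integrable setT (EFin \o (cst 1%R : T -> R)).
    exact: finite_measure_integrable_cst.
  apply: (@integrableZl _ _ _ mu _ measurableT C
     (EFin \o (cst 1%R \+ dens : T -> R))%R).
  exact: (integrableD measurableT ic id).
apply: (@integrableS _ _ _ mu setT) => //.
apply: le_integrable i1 => //; first exact/measurable_EFinP.
move=> x _ /=; rewrite lee_fin; apply: (le_trans (fC x)).
by rewrite ler_norm.
Qed.

Lemma nneseries_fine (u : (\bar R)^nat) : (forall n, 0 <= u n) ->
  (forall n, u n \is a fin_num) -> \sum_(0 <= n <oo) u n < +oo ->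
  cvgn (series (fine \o u)) /\
  limn (series (fine \o u)) = fine (\sum_(0 <= n <oo) u n).
Proof.
move=> u0 uf uoo.
have fE n : (series (fine \o u) n)%:E = \sum_(0 <= i < n) u i.
  by rewrite /series/= -sumEFin; apply: eq_bigr => i _; rewrite fineK.
have Sf : \sum_(0 <= n <oo) u n \is a fin_num.
  by rewrite ge0_fin_numE//; exact: nneseries_ge0.
have c : cvgn (series (fine \o u)).
  apply: nondecreasing_is_cvgn.
    by apply: nondecreasing_series => n _ _; exact: fine_ge0.
  exists (fine (\sum_(0 <= n <oo) u n)) => _ [n _ <-].
  by rewrite -lee_fin fineK// fE; exact: nneseries_lim_ge.
split => //; rewrite (_ : (fun n => _) = EFin \o series (fine \o u)).
  by rewrite EFin_lim.
by apply: funext => n /=; rewrite fE.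
Qed.

Lemma dominated_lin f g (a b : R) : dominated f -> dominated g ->
  dominated (fun x => a * f x + b * g x)%R.
Proof.
move=> [mf [C fC]] [mg [D gD]]; split.
  by apply: measurable_funD; apply: measurable_funM.
exists (`|a| * C + `|b| * D)%R => x.
rewrite mulrDl (le_trans (ler_normD _ _))// !normrM -!mulrA.
by rewrite lerD// ler_wpM2l.
Qed.

Lemma dominated_dens1 : dominated (fun x => 1 + dens x)%R.
Proof.
split; first by apply: measurable_funD => //; exact: measurable_dens.
by exists 1%R => x; rewrite mul1r ger0_norm// addr_ge0// dens_ge0.
Qed.

Lemma dominated_powR a : (0 <= a <= 1)%R -> dominated (fun x => dens x `^ a)%R.
Proof.
move=> a01; split.
  by apply: (measurableT_comp (measurable_powR _ )); exact: measurable_dens.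
by exists 1%R => x; rewrite mul1r ger0_norm ?powR_ge0// powR_le1D// dens_ge0.
Qed.

Lemma dominated_powln a : (0 < a < 1)%R -> dominated (powln a).
Proof.
move=> /andP[a0 a1]; split; first exact: measurable_powln.
exists (Order.min a (1 - a))^-1%R => x; apply: norm_powR_ln_le.
- exact: dens_ge0.
- by rewrite lt_min a0 subr_gt0.
- by rewrite ge_min lexx.
- by rewrite lerBrDl -lerBrDr ge_min lexx orbT.
Qed.

Definition tame B := [/\ forall n, measurable (B n),
  \sum_(0 <= n <oo) mu (B n) < +oo & \sum_(0 <= n <oo) nu (B n) < +oo].

(** This is the integral of f against the sum of the restrictions of [mu] to the sets [B n]. It is a
    real number by construction, so the optimization part can be carried out in R; the limit is
    meaningful for [dominated] f along a [tame] B. *)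
Definition Isum B f : R :=
  limn (series (fun n => \int[mu]_(x in B n) f x)%R).

Section Isum.
Variable B : (set T)^nat.
Hypothesis tB : tame B.

Definition tsize : R :=
  (fine (\sum_(0 <= n <oo) mu (B n)) + fine (\sum_(0 <= n <oo) nu (B n)))%R.

Let s n : R := (fine (mu (B n)) + fine (nu (B n)))%R.

Let mB n : measurable (B n). Proof. by case: tB. Qed.

Let s_cvg : cvgn (series s) /\ limn (series s) = tsize.
Proof.
case: tB => _ mf nf.
have [c1 l1] := nneseries_fine (fun n => measure_ge0 mu (B n))
  (fun n => fin_num_measure mu _ (mB n)) mf.
have [c2 l2] := nneseries_fine (fun n => measure_ge0 nu (B n))
  (fun n => fin_num_measure nu _ (mB n)) nf.
rewrite /tsize -l1 -l2 -lim_seriesD//; split=> //.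
exact: (is_cvg_seriesD c1 c2).
Qed.

Let Rintegral_dens1 n : (\int[mu]_(x in B n) (1 + dens x) = s n)%R.
Proof.
rewrite RintegralD//; last 2 first.
- exact: finite_measure_integrable_cst.
- have dd : dominated dens.
    split; first exact: measurable_dens.
    by exists 1%R => x; rewrite ger0_norm ?dens_ge0// mul1r lerDr.
  exact: dominated_integrable.
rewrite Rintegral_cst// mul1r /s; congr (_ + _)%R.
by rewrite /Rintegral integral_dens.
Qed.

Let Rintegral_norm_le f C n : dominated f ->
  (forall x, `|f x| <= C * (1 + dens x))%R ->
  (`|\int[mu]_(x in B n) f x| <= C * s n)%R.
Proof.
move=> df fC; apply: (le_trans (le_normr_Rintegral (mB n) _)).
  exact: dominated_integrable.
rewrite -Rintegral_dens1 -RintegralZl//; last first.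
  exact: dominated_integrable dominated_dens1.
apply: le_Rintegral => //.
- apply: (dominated_integrable (mB n)); case: df => mf [D fD]; split.
    exact: measurableT_comp.
  by exists D => x; rewrite normr_id.
- have := dominated_integrable (mB n) (dominated_lin C 0 dominated_dens1 dominated_dens1).
  by under eq_fun do rewrite mul0r addr0.
Qed.

Lemma Isum_cvg f : dominated f ->
  cvgn (series (fun n => \int[mu]_(x in B n) f x)%R).
Proof.
move=> df; have [_ [C fC]] := df; apply: normed_cvg.
have [sc _] := s_cvg.
apply: (@series_le_cvg _ _ (C *: s)).
- by move=> n; exact: normr_ge0.
- by move=> n; exact: (le_trans (normr_ge0 _) (Rintegral_norm_le n df fC)).
- by move=> n; exact: Rintegral_norm_le.
- exact: is_cvg_seriesZ.
Qed.

Lemma Isum_lin f g (a b : R) : dominated f -> dominated g ->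
  Isum B (fun x => a * f x + b * g x)%R = (a * Isum B f + b * Isum B g)%R.
Proof.
move=> df dg; have cf := Isum_cvg df; have cg := Isum_cvg dg.
rewrite /Isum -[(a * _)%R]lim_seriesZ// -[(b * _)%R]lim_seriesZ//.
rewrite -lim_seriesD; [|exact: is_cvg_seriesZ..].
congr (limn (series _)); apply: funext => n.
have i f' : dominated f' -> mu.-integrable (B n) (EFin \o f').
  exact: dominated_integrable.
have iZ f' c : dominated f' ->
    mu.-integrable (B n) (EFin \o (fun x => c * f' x)%R).
  move=> df'; apply: i; have := dominated_lin c 0 df' df'.
  by under eq_fun do rewrite mul0r addr0.
by rewrite RintegralD ?RintegralZl//; [exact: i|exact: i|exact: iZ|exact: iZ].
Qed.

Lemma Isum_le f g : dominated f -> dominated g ->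
  (forall x, f x <= g x)%R -> (Isum B f <= Isum B g)%R.
Proof.
move=> df dg fg; apply: lim_series_le; [exact: Isum_cvg|exact: Isum_cvg|].
by move=> n; apply: le_Rintegral => //; exact: dominated_integrable.
Qed.

Lemma Isum_norm_le f C : dominated f ->
  (forall x, `|f x| <= C * (1 + dens x))%R -> (`|Isum B f| <= C * tsize)%R.
Proof.
move=> df fC; have [sc sl] := s_cvg.
(* The null second summand casts a scalar multiple in the shape of [Isum_lin]. *)
have sE : Isum B (fun x => C * (1 + dens x) + 0 * (1 + dens x))%R = (C * tsize)%R.
  rewrite Isum_lin; [|exact: dominated_dens1..].
  rewrite mul0r addr0 -sl /Isum (_ : (fun n => _) = s)//.
  by apply: funext => n; exact: Rintegral_dens1.
have dC c : dominated (fun x => c * (1 + dens x) + 0 * (1 + dens x))%R.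
  exact: dominated_lin dominated_dens1 dominated_dens1.
rewrite ler_norml; apply/andP; split; last first.
  rewrite -sE; apply: Isum_le => // x; rewrite mul0r addr0.
  exact: le_trans (ler_norm _) (fC x).
have nE : Isum B (fun x => -1 * f x + 0 * f x)%R = (- Isum B f)%R.
  by rewrite Isum_lin// mul0r addr0 mulN1r.
rewrite lerNl -sE -nE.
apply: Isum_le => // [|x]; first exact: dominated_lin.
rewrite !mul0r !addr0 mulN1r (le_trans _ (fC x))//.
by rewrite -normrN ler_norm.
Qed.

Lemma Isum_eseries f : dominated f ->
  \sum_(0 <= n <oo) \int[mu]_(x in B n) (f x)%:E = (Isum B f)%:E.
Proof.
move=> df; rewrite -EFin_lim; last exact: Isum_cvg.
congr (limn _); apply: funext => n /=; rewrite /series/= -sumEFin.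
apply: eq_bigr => i _; rewrite /Rintegral fineK//.
by apply: integrable_fin_num => //; exact: dominated_integrable.
Qed.

End Isum.

End sum_integrals.

(** * One-sided derivatives of an infimum *)

Section danskin.
Context {R : realType} {I : Type}.
Local Open Scope ring_scope.
(* [m], [p s], [l s] and [phi] stand for mass, pow_sum s, powlog_sum s and Phi on
   the disjoint covers; [h s e], [H s], [psi u s e], [Psi s] for Heps s e,
   Hlim s, Psi1eps u s e and Psi1 s s. *)
Variables (good : I -> Prop) (m : I -> R) (p l : R -> I -> R) (phi : R).
Variables (H : R -> R) (h : R -> R -> R) (psi : R -> R -> R -> R) (Psi : R -> R).
Variables (J : R -> Prop) (K : R).
Implicit Types (s t u e r : R) (A : I).

Definition near_opt s e A := [/\ good A, m A < phi + e & p s A < H s + e].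

(** All that the optimization uses of the covers, with one constant K for a whole interval J.
    Convexity is stated through tangents. The infima [psi] run over all covers, whereas A ranges
    over the disjointified ones; the passage costs a multiple of the radius, hence the error K * e
    in [fam_psi_adherent]. *)
Record near_opt_family : Prop := NearOptFamily {
  fam_J_width : forall s t, J s -> J t -> `|t - s| <= 1;
  fam_K_ge1 : 1 <= K;
  fam_p_tangent : forall s t A, J s -> J t -> good A ->
    (t - s) * l s A <= p t A - p s A;
  fam_l_norm : forall s A, J s -> good A -> `|l s A| <= K;
  fam_l_lip : forall s t A, J s -> J t -> good A ->
    `|l t A - l s A| <= K * `|t - s|;
  fam_h_le : forall s e A, J s -> 0 < e <= 1 -> good A -> m A < phi + e ->
    h s e <= p s A;
  fam_h_lim : forall s d, J s -> 0 < d -> exists2 e, 0 < e <= 1 &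
    forall e', 0 < e' <= e -> H s - d < h s e';
  fam_psi_le : forall u s e A, J u -> J s -> 0 < e <= 1 ->
    near_opt s e A -> psi u s e <= l u A;
  fam_psi_adherent : forall u s e, J u -> J s -> 0 < e <= 1 ->
    exists2 A, near_opt s e A & l u A < psi u s e + K * e;
  fam_psi_Psi : forall s e, J s -> 0 < e <= 1 -> psi s s e <= Psi s;
  fam_Psi_lim : forall s d, J s -> 0 < d -> exists2 e, 0 < e <= 1 &
    forall e', 0 < e' <= e -> Psi s - d < psi s s e';
  fam_Psi_norm : forall s, J s -> `|Psi s| <= K
}.

Hypothesis fam : near_opt_family.

Let J_width := fam_J_width fam.
Let K_ge1 := fam_K_ge1 fam.
Let p_tangent := fam_p_tangent fam.
Let l_norm := fam_l_norm fam.
Let l_lip := fam_l_lip fam.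
Let h_le := fam_h_le fam.
Let h_lim := fam_h_lim fam.
Let psi_le := fam_psi_le fam.
Let psi_adherent := fam_psi_adherent fam.
Let psi_Psi := fam_psi_Psi fam.
Let Psi_lim := fam_Psi_lim fam.
Let Psi_norm := fam_Psi_norm fam.

Lemma K_gt0 : 0 < K. Proof. exact: lt_le_trans K_ge1. Qed.

(** A cover that is near-optimal at s with slope close to Psi(s) is tested at t: convexity with the
    tangent at t, then the Lipschitz bound on the slope, gives the quadratic error. The estimate
    holds for both signs of t - s. *)
Lemma H_upper s t : J s -> J t ->
  H t <= H s + (t - s) * Psi s + K * (t - s) ^+ 2.
Proof.
move=> Js Jt; apply/ler_addgt0Pr => d d0; have K0 := K_gt0.
(* The losses are at most d' from [h], d' from the radius and d' * (1 + K) from the slope. *)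
pose d' := Order.min 1 (d / (4 + K)).
have d'0 : 0 < d' by rewrite /d' lt_min ltr01 divr_gt0//; lra.
have d'd : d' * (4 + K) <= d.
  by rewrite /d' -ler_pdivlMr ?ge_min ?lexx ?orbT//; lra.
have [e1 /andP[e10 e11] he] := h_lim Jt d'0.
have [e2 /andP[e20 e21] Pe] := Psi_lim Js d'0.
pose e := Order.min d' (Order.min e1 e2).
have e0 : 0 < e by rewrite /e lt_min d'0 lt_min e10 e20.
have ed' : e <= d' by rewrite /e ge_min lexx.
have ee1 : e <= e1 by rewrite /e ge_min [X in _ || X]ge_min lexx ?orbT.
have ee2 : e <= e2 by rewrite /e ge_min [X in _ || X]ge_min lexx ?orbT.
have e01 : 0 < e <= 1 by rewrite e0 (le_trans ee1).
have [A [gA mA pA] lA] := psi_adherent Js Js e01.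
have h1 := he e ltac:(by rewrite e0 ee1); have h2 := h_le Jt e01 gA mA.
have h3 := Pe e ltac:(by rewrite e0 ee2); have h4 := psi_Psi Js e01.
have h5 := psi_le Js Js e01 (And3 gA mA pA).
have h6 := p_tangent Jt Js gA; have h7 := l_lip Js Jt gA.
have h8 := J_width Js Jt.
have n0 := normr_ge0 (t - s).
have h9 : (t - s) * (l t A - l s A) <= K * (t - s) ^+ 2.
  rewrite (le_trans (ler_norm _))// normrM -[(t - s) ^+ 2]real_normK ?num_real//.
  rewrite expr2 mulrCA; exact: ler_wpM2l.
have h10 : (t - s) * (l s A - Psi s) <= d' * (1 + K).
  rewrite (le_trans (ler_norm _))// normrM -[leRHS]mul1r.
  apply: ler_pM => //; rewrite ler_norml; apply/andP; split; nra.
nra.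
Qed.

Lemma H_slope s t : J s -> J t -> s < t ->
  Psi t - K * (t - s) <= (H t - H s) / (t - s) <= Psi s + K * (t - s).
Proof.
move=> Js Jt st; have ts : 0 < t - s by rewrite subr_gt0.
have h1 := H_upper Js Jt; have h2 := H_upper Jt Js.
apply/andP; split; first by rewrite ler_pdivlMr//; nra.
by rewrite ler_pdivrMr//; nra.
Qed.

(** The three terms K |t - s| pay for the change of p along A, the linear part of H(s) - H(t), and
    its quadratic part, which is at most linear because J has width at most 1. *)
Lemma near_opt_shift s t e A : J s -> J t -> near_opt s e A ->
  near_opt t (e + 3 * K * `|t - s|) A.
Proof.
move=> Js Jt [gA mA pA]; have K0 := K_gt0.
have n0 := normr_ge0 (t - s); have n1 := J_width Js Jt.
split=> //; first by nra.
have h1 := p_tangent Jt Js gA; have h2 := H_upper Jt Js.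
have h3 : (t - s) * l t A <= K * `|t - s|.
  rewrite (le_trans (ler_norm _))// normrM mulrC.
  by rewrite ler_wpM2r// l_norm.
have h4 : (s - t) * Psi t <= K * `|t - s|.
  rewrite (le_trans (ler_norm _))// normrM distrC mulrC.
  by rewrite ler_wpM2r// Psi_norm.
have h5 : (s - t) ^+ 2 <= `|t - s|.
  rewrite -sqrrN opprB -[(t - s) ^+ 2]real_normK ?num_real// expr2.
  by rewrite -[leRHS]mul1r ler_wpM2r.
nra.
Qed.

(** A cover almost attaining [psi u s e] becomes, by [near_opt_shift], a competitor at t for the
    enlarged radius; its slopes at u and t differ by at most K |t - s|. *)
Lemma psi_lower s t u e : J s -> J t -> J u -> `|u - t| <= `|t - s| ->
  0 < e -> e + 3 * K * `|t - s| <= 1 ->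
  psi t t (e + 3 * K * `|t - s|) <= psi u s e + K * e + K * `|t - s|.
Proof.
move=> Js Jt Ju ut e0 e1; have K0 := K_gt0; have n0 := normr_ge0 (t - s).
have e01 : 0 < e <= 1 by rewrite e0; nra.
have [A nA lA] := psi_adherent Ju Js e01.
have e'01 : 0 < e + 3 * K * `|t - s| <= 1 by rewrite e1 andbT; nra.
have h1 := psi_le Jt Jt e'01 (near_opt_shift Js Jt nA).
case: nA => gA _ _; have h2 := l_lip Ju Jt gA.
move: h2; rewrite distrC => /ler_normlP[h2 _].
rewrite distrC in ut.
have h3 : K * `|t - u| <= K * `|t - s| by rewrite ler_wpM2l// ltW.
lra.
Qed.

Lemma Psi_lsc t d : J t -> 0 < d -> exists2 r, 0 < r &
  forall s, J s -> `|t - s| < r -> Psi t - d < Psi s.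
Proof.
move=> Jt d0; have K0 := K_gt0.
have d20 : 0 < d / 2 by rewrite divr_gt0.
have [e /andP[e0 e1] he] := Psi_lim Jt d20.
(* [psi_lower] is applied below with radius |t - s| itself, so that radius and shift vanish
   together; the shifted radius is then (1 + 3 K) |t - s|. A radius has to be positive, whence the
   separate case t = s. *)
pose r := Order.min (e / (1 + 3 * K)) (d / (8 * K)).
exists r; first by rewrite /r lt_min !divr_gt0//; nra.
move=> s Js; rewrite lt_min => /andP[].
rewrite !ltr_pdivlMr; [|nra..]; move=> r1 r2.
have [->|ts] := eqVneq t s; first by rewrite ltrBlDr ltrDl.
have n0 : 0 < `|t - s| by rewrite normr_gt0 subr_eq0.
have n1 := J_width Js Jt.
have e'e : `|t - s| + 3 * K * `|t - s| <= e by nra.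
have e'0 : 0 < `|t - s| + 3 * K * `|t - s| by nra.
have h1 := he (`|t - s| + 3 * K * `|t - s|) ltac:(by rewrite e'0).
have h2 := @psi_lower s t s `|t - s| Js Jt Js ltac:(by rewrite distrC) n0
  ltac:(by rewrite (le_trans e'e)).
have h3 := psi_Psi Js (e := `|t - s|) ltac:(by rewrite n0).
lra.
Qed.

(** A cover near-optimal at s with almost minimal slope at t is used at both exponents. The excess e
    at s and the gap r at t are divided by t - s, so they must be small compared with it. *)
Lemma slope_le_psi s t e r : J s -> J t -> s < t -> 0 < e <= 1 ->
  H t - r < h t e ->
  (H t - H s) / (t - s) <= psi t s e + K * e + (r + e) / (t - s).
Proof.
move=> Js Jt st e01 hr; have ts : 0 < t - s by rewrite subr_gt0.
have [A [gA mA pA] lA] := psi_adherent Jt Js e01.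
have h1 := h_le Jt e01 gA mA; have h2 := p_tangent Jt Js gA.
rewrite -lerBlDr -mulrBl ler_pdivrMr//; nra.
Qed.

Lemma psi_lip u u' s e : J u -> J u' -> J s -> 0 < e <= 1 ->
  psi u s e <= psi u' s e + K * `|u - u'| + K * e.
Proof.
move=> Ju Ju' Js e01; have [A nA lA] := psi_adherent Ju' Js e01.
have h1 := psi_le Ju Js e01 nA; case: nA => gA _ _.
have := l_lip Ju' Ju gA => /ler_normlP[_ h2]; lra.
Qed.

(* The radius [eps_tau] of the left-hand limits, with [e] for [delta_tau] and
   [r] for [(t - s) `^ tau]. *)
Definition radius s t e r :=
  (t - s) * (psi t s e - psi s t e) + 2 * r + 3 * e.

(** This is where [eps_tau] comes from. Let A be near-optimal at t, and B near-optimal at s with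
    slope at t close to [psi t s e]. Going from p s A to p t A costs - (t - s) [psi s t e],
    comparing with p t B costs r, and returning to p s B costs (t - s) [psi t s e], up to multiples
    of e. So A has excess below [radius] at s and competes in [psi u s]. The second r makes [radius]
    positive, through H s - r < [h s e]. *)
Lemma radius_upper s t u e r : J s -> J t -> J u -> s < t ->
  `|u - t| <= `|t - s| -> K * (t - s) <= 2^-1 -> 0 < e <= 1 -> 0 < r ->
  H t - r < h t e -> H s - r < h s e ->
  0 < radius s t e r <= 2 * K * (t - s) + K * (t - s) * e + 2 * r + 3 * e /\
  (radius s t e r <= 1 ->
   psi u s (radius s t e r) <= Psi t + K * e + K * (t - s)).
Proof.
move=> Js Jt Ju st ut Kts e01 r0 ht hs; have K0 := K_gt0.
have ts : 0 < t - s by rewrite subr_gt0.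
have /andP[e0 e1] := e01.
(* Half the radius at t, because A must also keep its mass bound for the new radius, of which
   [rad_ge] provides only that it exceeds e / 2. *)
have e20 : 0 < e / 2 <= 1 by lra.
have [A [gA mA pA] lA] := psi_adherent Jt Jt e20.
have [B [gB mB pB] lB] := psi_adherent Jt Js e01.
have mA' : m A < phi + e by lra.
have nA : near_opt t e A by split=> //; lra.
have h1 := psi_le Js Jt e01 nA.
have h2 := p_tangent Js Jt gA; have h3 := p_tangent Jt Js gB.
have h4 := h_le Jt e01 gB mB; have h5 := h_le Js e01 gA mA'.
have h6 := psi_Psi Jt e20.
have h7 : (t - s) * psi s t e <= (t - s) * l s A by rewrite ler_wpM2l// ltW.
have h8 : (t - s) * l t B <= (t - s) * (psi t s e + K * e).
  by rewrite ler_wpM2l// ltW.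
have h9 : K * (t - s) * e <= 2^-1 * e by rewrite ler_wpM2r// ltW.
have h10 : (t - s) * (K * e) = K * (t - s) * e by ring.
have radE : radius s t e r =
  (t - s) * psi t s e - (t - s) * psi s t e + 2 * r + 3 * e.
  by rewrite /radius; ring.
rewrite mulrDr h10 in h8.
have rad_ge : e / 2 < radius s t e r by rewrite radE; lra.
have [A1 nA1 lA1] := psi_adherent Js Jt e01.
have h11 : psi t s e <= K.
  have h11 := psi_le Jt Js e01 (And3 gB mB pB).
  by apply: (le_trans h11); apply: (le_trans (ler_norm _)); exact: l_norm.
have h12 : - K <= psi s t e + K * e.
  case: nA1 => gA1 _ _; have := l_norm Js gA1 => /ler_normlP[h12 _]; lra.
have h13 : (t - s) * psi t s e <= (t - s) * K by rewrite ler_wpM2l// ltW.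
have h14 : (t - s) * - K <= (t - s) * (psi s t e + K * e).
  by rewrite ler_wpM2l// ltW.
split.
  apply/andP; split; first by lra.
  rewrite radE; lra.
move=> rad1; have rad01 : 0 < radius s t e r <= 1 by rewrite rad1 andbT; lra.
have nA' : near_opt s (radius s t e r) A.
  split=> //; first by lra.
  by rewrite radE; lra.
have h15 := psi_le Ju Js rad01 nA'.
have := l_lip Jt Ju gA => /ler_normlP[_ h16].
have h17 : K * `|u - t| <= K * (t - s).
  by rewrite ler_wpM2l ?(ltW K0)// (le_trans ut)// gtr0_norm.
have h18 : 0 <= K * e by rewrite mulr_ge0// ltW.
lra.
Qed.

Lemma psi_radius_lim t d : J t -> 0 < d -> exists2 q, 0 < q &
  forall s u e r, J s -> J u -> s < t -> `|u - t| <= `|t - s| -> t - s < q ->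
    0 < e <= r -> r < q -> H t - r < h t e -> H s - r < h s e ->
    0 < radius s t e r <= 1 /\ `|Psi t - psi u s (radius s t e r)| < d.
Proof.
move=> Jt d0; have K0 := K_gt0.
have d20 : 0 < d / 2 by rewrite divr_gt0.
have [e1 /andP[e10 e11] he] := Psi_lim Jt d20.
(* The radius is at most 8 K q, and shifting a cover from s to t adds 3 K q; together 11 K q has to
   stay below e1. *)
pose q := Order.min (e1 / (1 + 11 * K)) (d / (8 * K * (1 + 11 * K))).
have q0 : 0 < q.
  by rewrite /q lt_min !divr_gt0//; nra.
have qe1 : q * (1 + 11 * K) <= e1.
  by rewrite /q -ler_pdivlMr ?ge_min ?lexx//; nra.
have qd : q * (8 * K * (1 + 11 * K)) <= d.
  by rewrite /q -ler_pdivlMr ?ge_min ?lexx ?orbT//; nra.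
exists q => // s u e r Js Ju st ut tsq /andP[e0 er] rq ht hs.
have ts : 0 < t - s by rewrite subr_gt0.
have nts : `|t - s| = t - s by rewrite gtr0_norm.
have Kq : q <= K * q by rewrite ler_peMl// ltW.
have Kts : K * (t - s) <= K * q by rewrite ler_wpM2l// ltW.
have Kts2 : K * (t - s) <= 2^-1 by nra.
have e01 : 0 < e <= 1 by rewrite e0; nra.
have r0 : 0 < r by lra.
have [/andP[rad0 radle] radP] := radius_upper Js Jt Ju st ut Kts2 e01 r0 ht hs.
set w := radius s t e r in rad0 radle radP *.
have h1 : K * (t - s) * e <= e by rewrite ler_piMl ?(ltW e0)//; lra.
have wq : w <= 8 * (K * q) by lra.
have w3 : w + 3 * K * `|t - s| <= e1 by rewrite nts; nra.
have w1 : w <= 1 by rewrite nts in w3; nra.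
have w4 : w + 3 * K * `|t - s| <= 1 by lra.
split; first by rewrite rad0 w1.
have h2 := radP w1.
have h3 := psi_lower Js Jt Ju ut rad0 w4.
have h4 : 0 < w + 3 * K * `|t - s| by rewrite nts; nra.
have h5 := he (w + 3 * K * `|t - s|) ltac:(by rewrite h4 w3).
have h6 : K * w <= K * (8 * (K * q)) by rewrite ler_wpM2l// ltW.
have h7 : K * e <= K * q by rewrite ler_wpM2l//; lra.
have qd' : 8 * (K * q) + 88 * (K * (K * q)) <= d.
  by move: qd; rewrite (_ : q * _ = 8 * (K * q) + 88 * (K * (K * q)))//; ring.
have h8 : K * q <= K * (K * q) by rewrite ler_wpM2l// ltW.
have h9 : 0 < K * q by rewrite mulr_gt0.
rewrite nts in h3 h5; rewrite ltr_norml.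
apply/andP; split; lra.
Qed.

(** [H_slope] squeezes the slope between Psi(s) and Psi(t) up to K (s - t). With Psi(s) > Psi(t) - d
    / 2 from [Psi_lsc], the slope and Psi(s) both converge to Psi(t). *)
Lemma slope_right_lim t d : J t -> 0 < d -> exists2 q, 0 < q &
  forall s, J s -> t < s -> s - t < q ->
    `|Psi t - (H s - H t) / (s - t)| < d /\ `|Psi t - Psi s| < d.
Proof.
move=> Jt d0; have K0 := K_gt0.
have d20 : 0 < d / 2 by rewrite divr_gt0.
have [q q0 Pq] := Psi_lsc Jt d20.
exists (Order.min q (d / (4 * K))); first by rewrite lt_min q0 divr_gt0// mulr_gt0.
move=> s Js ts; rewrite lt_min => /andP[sq].
rewrite ltr_pdivlMr ?mulr_gt0// => sK.
have nts : `|t - s| = s - t by rewrite distrC gtr0_norm ?subr_gt0.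
have /andP[h1 h2] := H_slope Jt Js ts.
have h3 := Pq s Js ltac:(by rewrite nts).
by split; rewrite ltr_norml; apply/andP; split; lra.
Qed.

Lemma slope_left_ge t d : J t -> 0 < d -> exists2 q, 0 < q &
  forall s, J s -> s < t -> t - s < q -> Psi t <= (H s - H t) / (s - t) + d.
Proof.
move=> Jt d0; have K0 := K_gt0.
exists (d / K); first exact: divr_gt0.
move=> s Js st; rewrite ltr_pdivlMr// => sK.
have /andP[h1 _] := H_slope Js Jt st.
have -> : (H s - H t) / (s - t) = (H t - H s) / (t - s).
  by rewrite -(opprB (H t)) -(opprB t) invrN mulrNN.
lra.
Qed.

Lemma slope_left_le t d : J t -> 0 < d -> exists2 q, 0 < q &
  forall s e r, J s -> s < t -> 0 < e <= r -> r < q * (t - s) -> t - s < 1 ->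
    H t - r < h t e -> (H s - H t) / (s - t) <= psi t s e + d.
Proof.
move=> Jt d0; have K0 := K_gt0.
pose q := Order.min 1 (d / (K + 2)).
have q0 : 0 < q by rewrite /q lt_min ltr01 divr_gt0//; lra.
have q1 : q <= 1 by rewrite /q ge_min lexx.
have qK : q * (K + 2) <= d.
  by rewrite -ler_pdivlMr; [rewrite /q ge_min lexx orbT|lra].
exists q => // s e r Js st /andP[e0 er] rq ts1 ht.
have ts : 0 < t - s by rewrite subr_gt0.
have rq' : r < q by nra.
have e01 : 0 < e <= 1 by rewrite e0; lra.
have h1 := slope_le_psi Js Jt st e01 ht.
have h2 : (r + e) / (t - s) <= 2 * q by rewrite ler_pdivrMr//; lra.
have h3 : K * e <= K * q by rewrite ler_wpM2l ?(ltW K0)//; lra.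
have -> : (H s - H t) / (s - t) = (H t - H s) / (t - s).
  by rewrite -(opprB (H t)) -(opprB t) invrN mulrNN.
lra.
Qed.

Lemma psi_swap_le d : 0 < d -> exists2 q, 0 < q &
  forall u u' s e, J s -> J u -> J u' -> `|u - u'| < q -> 0 < e < q ->
    psi u s e <= psi u' s e + d.
Proof.
move=> d0; have K0 := K_gt0.
pose q := Order.min 1 (d / (2 * K)).
have q0 : 0 < q by rewrite /q lt_min ltr01 divr_gt0// mulr_gt0.
have q1 : q <= 1 by rewrite /q ge_min lexx.
have qK : q * (2 * K) <= d.
  by rewrite -ler_pdivlMr; [rewrite /q ge_min lexx orbT|rewrite mulr_gt0].
exists q => // u u' s e Js Ju Ju' uu' /andP[e0 eq].
have e01 : 0 < e <= 1 by rewrite e0; lra.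
have h1 := psi_lip Ju Ju' Js e01.
have h2 : K * e <= K * q by rewrite ler_wpM2l ?(ltW K0)//; lra.
have h3 : K * `|u - u'| <= K * q by rewrite ler_wpM2l ?(ltW K0)//; lra.
lra.
Qed.

End danskin.

(** * Limits *)

Lemma limf_einf_le {R : realType} (F : set_system R) {FF : Filter F}
  (f g : R -> \bar R) :
  (forall d : R, (0 < d)%R -> \forall x \near F, f x <= g x + d%:E) ->
  limf_einf f F <= limf_einf g F.
Proof.
move=> fg; rewrite !limf_einfE; apply: ge_ereal_sup => _ [V FV <-].
apply/lee_addgt0Pr => d d0; rewrite -leeBlDr//.
apply: ereal_sup_ge; eexists.
  (* Shrinking V to where the comparison holds can only raise the infimum of f. *)
  exists (V `&` [set x | f x <= g x + d%:E]) => //.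
  by apply: filterI => //; exact: fg.
apply: le_ereal_inf_tmp => _ [x [Vx fgx] <-]; rewrite leeBlDr//.
by apply: le_trans fgx; apply: ereal_inf_lbound; exists x.
Qed.

Lemma limf_einf_ge {R : realType} (F : set_system R) {FF : Filter F}
  (f : R -> \bar R) (c : \bar R) :
  (forall d : R, (0 < d)%R -> \forall x \near F, c <= f x + d%:E) ->
  c <= limf_einf f F.
Proof.
move=> cf; apply: (le_trans _ (limf_einf_le (f := cst c) cf)).
rewrite limf_einfE; apply: ereal_sup_ge; eexists.
  by exists setT => //; exact: filterT.
by apply: le_ereal_inf_tmp => _ [x _ <-].
Qed.

Lemma cvg_EFin_dist {R : realType} (F : set_system R) {FF : Filter F}
  (f : R -> \bar R) (l : R) :
  (forall d : R, (0 < d)%R -> \forall x \near F,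
     exists2 r : R, f x = r%:E & (`|l - r| < d)%R) ->
  f x @[x --> F] --> l%:E.
Proof.
move=> fl; apply/fine_cvgP; split.
  by apply: filterS (fl 1%R ltr01) => x [r ->].
apply/cvgrPdist_lt => d d0.
by apply: filterS (fl d d0) => x [r /= ->].
Qed.

Lemma at_leftW {R : realType} (t : R) (P : R -> Prop) :
  (exists2 q : R, (0 < q)%R & forall s, (s < t)%R -> (t - s < q)%R -> P s) ->
  \forall s \near t^'-, P s.
Proof.
move=> [q q0 qP]; near=> s; apply: qP; first by near: s; exact: nbhs_left_lt.
by rewrite ltrBlDr -ltrBlDl; near: s; apply: nbhs_left_gt; rewrite ltrBlDr ltrDl.
Unshelve. all: by end_near. Qed.

Lemma at_rightW {R : realType} (t : R) (P : R -> Prop) :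
  (exists2 q : R, (0 < q)%R & forall s, (t < s)%R -> (s - t < q)%R -> P s) ->
  \forall s \near t^'+, P s.
Proof.
move=> [q q0 qP]; near=> s; apply: qP; first by near: s; exact: nbhs_right_gt.
by rewrite ltrBlDr addrC; near: s; apply: nbhs_right_lt; rewrite ltrDl.
Unshelve. all: by end_near. Qed.

Lemma powR_small {R : realType} (tau q : R) : (0 < tau)%R -> (0 < q)%R ->
  exists2 r : R, (0 < r)%R & forall x, (0 < x)%R -> (x < r)%R -> (x `^ tau < q)%R.
Proof.
move=> tau0 q0; exists (q `^ tau^-1)%R; first exact: powR_gt0.
move=> x x0 xq; rewrite -[ltRHS](_ : (q `^ tau^-1) `^ tau = _)%R.
  by apply: gt0_ltr_powR => //; rewrite nnegrE ?powR_ge0 ?(ltW x0).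
by rewrite -powRrM mulVf ?gt_eqF// powRr1// ltW.
Qed.

Lemma diff_quotE {R : realType} (f : R -> \bar R) (a b : R) :
  f a \is a fin_num -> f b \is a fin_num ->
  diff_quot f a b = ((fine (f b) - fine (f a)) / (b - a))%:E.
Proof. by move=> fa fb; rewrite EFinM EFinB !fineK. Qed.

Lemma nneseriesB {R : realType} (w v : (\bar R)^nat) :
  (forall n, 0 <= w n) -> (forall n, 0 <= v n) ->
  \sum_(0 <= n <oo) v n < +oo ->
  \sum_(0 <= n <oo) (w n - v n) = \sum_(0 <= n <oo) w n - \sum_(0 <= n <oo) v n.
Proof.
move=> w0 v0 voo.
have v0' := nneseries_ge0 (fun n (_ : (0 <= n)%N) (_ : true) => v0 n).
have vfin : \sum_(0 <= n <oo) v n \is a fin_num by rewrite ge0_fin_numE.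
have vk n : v n \is a fin_num.
  rewrite ge0_fin_numE//; apply: le_lt_trans voo.
  apply: (le_trans _ (nneseries_lim_ge n.+1 _)) => //.
  rewrite big_nat_recr//= lee_paddl// sume_ge0//.
have sE n : \sum_(0 <= i < n) (w i - v i) =
    \sum_(0 <= i < n) w i - \sum_(0 <= i < n) v i.
  rewrite big_split/= -fin_num_sumeN//.
apply: cvg_lim => //; under eq_fun do rewrite sE.
apply: cvgeB; first by rewrite fin_num_adde_defl// fin_numN.
- exact: is_cvg_nneseries.
- exact: is_cvg_nneseries.
Qed.

Lemma lim_at_right_antitone {R : realType} (f : R -> \bar R) :
  (forall e e' : R, (0 < e)%R -> (e <= e')%R -> f e' <= f e) ->
  (forall e, (0 < e)%R -> f e <= lim (f e @[e --> (0%R : R)^'+])) /\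
  (forall x, x < lim (f e @[e --> (0%R : R)^'+]) -> exists2 e0, (0 < e0 <= 1)%R &
     forall e, (0 < e <= e0)%R -> x < f e).
Proof.
move=> f_anti.
have := @nonincreasing_at_right_cvge R f 0%R +oo%O isT.
have nf : {in `]0%R, +oo[ &, nonincreasing_fun f}.
  move=> e e' /=; rewrite !in_itv/= !andbT => e0 e'0 ee'; exact: f_anti.
move=> /(_ nf) /cvg_lim ->//; split=> [e e0|x].
  by apply: ereal_sup_ubound; exists e => //=; rewrite in_itv/= e0.
move=> /ereal_sup_gt[_ [e0 /= + <-] xf]; rewrite in_itv/= andbT => e00.
(* The cap at 1 matches the radii allowed in [near_opt_family]. *)
exists (Order.min e0 1%R); first by rewrite lt_min e00 ltr01 ge_min lexx orbT.
move=> e /andP[e_gt0]; rewrite le_min => /andP[ee0 _].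
exact: lt_le_trans xf (f_anti _ _ e_gt0 ee0).
Qed.

(** * Near-optimal covers *)

Section good_covers.
Context {R : realType} {X : pointedType} (S : X -> X) (AA : set (set X)).
Local Notation T := (space0 S AA).
Variables (phi0 Lambda : {finite_measure set T -> \bar R}).
Variables (Z : T -> \bar R) (Q : set X).
Hypothesis S_inj : injective S.
Hypothesis Lambda_inv : forall A : set T,
  measurable A -> Lambda (S @^-1` A) = Lambda A.
Hypothesis Z_meas : measurable_fun setT Z.
Hypothesis Z_ge0 : forall x, 0 <= Z x.
Hypothesis Z_density : forall A : set T,
  measurable A -> Lambda A = \int[phi0]_(x in A) Z x.
Implicit Types (A : (set X)^nat) (a s t : R).

Local Notation mass := (mass phi0).
Local Notation Phi := (Phi phi0 Q).
Local Notation pow_sum := (pow_sum phi0 Z).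
Local Notation powlog_sum := (powlog_sum phi0 Z).
Local Notation dens := (dens Z).
Local Notation dominated := (dominated Z).
Local Notation dens1 := (dominated_dens1 Z_meas Z_ge0).

Lemma mass_ge0 A : covers S AA Q A -> 0 <= mass A.
Proof. by move=> _; apply: nneseries_ge0. Qed.

Lemma pow_sum_ge0 a A : 0 <= pow_sum a A.
Proof.
apply: nneseries_ge0 => n _ _; apply: integral_ge0 => x _; exact: poweR_ge0.
Qed.

Lemma Phi_fin_num : Phi \is a fin_num.
Proof.
rewrite ge0_fin_numE; last by apply: le_ereal_inf_tmp => _ [A cA <-]; exact: mass_ge0.
(* The cover by X alone, whose mass is the finite number phi0(X). *)
pose B := fun n : nat => if n == 0%N then [set: X] else set0.
have mB n : measurable (B n : set T) by rewrite /B; case: ifP.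
have cB : covers S AA Q (iter_cover S B).
  by apply: (covers_iter_cover mB) => x _; exists 0%N => //; exists x.
apply: (@le_lt_trans _ _ (mass (iter_cover S B))).
  by apply: ereal_inf_lbound; exists (iter_cover S B).
rewrite /mass pull_iter_cover// (nneseriesD1 (n := 0%N))//.
rewrite eseries0 ?adde0.
  by rewrite /B eqxx -ge0_fin_numE//; exact: fin_num_measure.
by move=> i _ i0; rewrite /B (negbTE i0) measure0.
Qed.

(** Of the disjointness of a refined cover only its consequence, the bound on the first moment, is
    retained. The slack 1 accommodates every radius e <= 1. *)
Definition good A := [/\ covers S AA Q A, mass A < Phi + 1 &
  \sum_(0 <= n <oo) Lambda (pull S A n) <= Lambda setT].

Lemma mass_lty A : mass A < Phi + 1 -> mass A < +oo.
Proof.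
by move=> /lt_trans; apply; rewrite -ge0_fin_numE ?fin_numD ?Phi_fin_num//;
  rewrite adde_ge0//; apply: le_ereal_inf_tmp => _ [B cB <-]; exact: mass_ge0.
Qed.

Lemma good_tame A : good A -> tame phi0 Lambda (pull S A).
Proof.
move=> [cA mA lA]; have [mB _] := coversP S_inj cA; split => //.
  exact: (mass_lty mA).
apply: (le_lt_trans lA); rewrite -ge0_fin_numE//; exact: fin_num_measure.
Qed.

Definition rmass A : R := fine (mass A).
Definition rpow a A : R := Isum phi0 (pull S A) (fun x => dens x `^ a)%R.
Definition rlog a A : R := Isum phi0 (pull S A) (powln Z a).

Lemma massE A : good A -> mass A = (rmass A)%:E.
Proof.
move=> [cA mA _]; rewrite /rmass fineK// ge0_fin_numE ?mass_ge0//.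
exact: mass_lty mA.
Qed.

Lemma pow_sumE a A : (0 <= a <= 1)%R -> good A -> pow_sum a A = (rpow a A)%:E.
Proof.
move=> a01 gA; have tA := good_tame gA.
rewrite -(Isum_eseries Z_meas Z_ge0 Z_density tA (dominated_powR Z_meas Z_ge0 a01)).
apply: eq_eseriesr => n _; have [mB _ _] := tA.
exact: (integral_poweR Z_meas Z_ge0 Z_density).
Qed.

Lemma powlog_sumE a A : (0 < a < 1)%R -> good A -> powlog_sum a A = (rlog a A)%:E.
Proof.
move=> a01 gA; have tA := good_tame gA.
rewrite -(Isum_eseries Z_meas Z_ge0 Z_density tA (dominated_powln Z_meas Z_ge0 a01)).
apply: eq_eseriesr => n _; have [mB _ _] := tA; have /andP[a0 _] := a01.
exact: (integral_poweR_lne Z_meas Z_ge0 Z_density).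
Qed.

(* [x `^ a * ln x + 1 / a >= 0], so the truncation of a cover raises
   [powlog_sum] by at most [1 / a] times the mass which is removed. *)
Lemma powlog_sum_mono a (B B' : (set T)^nat) : (0 < a < 1)%R ->
  (forall n, measurable (B n)) -> (forall n, measurable (B' n)) ->
  (forall n, B' n `<=` B n) -> \sum_(0 <= n <oo) phi0 (B n) < +oo ->
  \sum_(0 <= n <oo) \int[phi0]_(x in B' n) (Z x `^ a * lne (Z x))
    + (a^-1)%:E * \sum_(0 <= n <oo) phi0 (B' n) <=
  \sum_(0 <= n <oo) \int[phi0]_(x in B n) (Z x `^ a * lne (Z x))
    + (a^-1)%:E * \sum_(0 <= n <oo) phi0 (B n).
Proof.
move=> a01 mB mB' BB Boo; have /andP[a0 _] := a01.
have c0 : (0 <= a^-1)%R by rewrite invr_ge0 ltW.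
pose g x := (powln Z a x + a^-1)%R.
have dl := dominated_powln Z_meas Z_ge0 a01.
have g0 x : 0 <= (g x)%:E.
  rewrite lee_fin /g -lerBlDr sub0r.
  exact: powR_ln_ge (dens_ge0 Z_ge0 x) a0.
have intE (D : set T) : measurable D ->
    \int[phi0]_(x in D) (Z x `^ a * lne (Z x)) =
    \int[phi0]_(x in D) (g x)%:E - (a^-1)%:E * phi0 D.
  move=> mD; rewrite (integral_poweR_lne Z_meas Z_ge0 Z_density)//.
  have i1 := dominated_integrable Z_meas Z_ge0 Z_density mD dl.
  rewrite [X in _ = X - _](_ : _ = \int[phi0]_(x in D)
      ((EFin \o powln Z a) x + (EFin \o cst a^-1%R) x))//.
  rewrite integralD//; last exact: finite_measure_integrable_cst.
  rewrite /= integral_cst// addeK//.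
  by rewrite fin_numM//; exact: fin_num_measure.
have sumE (D : (set T)^nat) : (forall n, measurable (D n)) ->
    \sum_(0 <= n <oo) phi0 (D n) < +oo ->
    \sum_(0 <= n <oo) \int[phi0]_(x in D n) (Z x `^ a * lne (Z x))
    + (a^-1)%:E * \sum_(0 <= n <oo) phi0 (D n) =
    \sum_(0 <= n <oo) \int[phi0]_(x in D n) (g x)%:E.
  move=> mD Doo.
  have Df : \sum_(0 <= n <oo) phi0 (D n) \is a fin_num.
    by rewrite ge0_fin_numE//; exact: nneseries_ge0.
  rewrite (eq_eseriesr (fun n _ => intE (D n) (mD n))).
  rewrite nneseriesB//.
  - by rewrite nneseriesZl// subeK// fin_numM.
  - by move=> n; exact: integral_ge0.
  - by move=> n; rewrite mule_ge0.
  - by rewrite nneseriesZl// lte_mul_pinfty.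
have B'oo : \sum_(0 <= n <oo) phi0 (B' n) < +oo.
  apply: le_lt_trans Boo; apply: lee_nneseries => // n _.
  by apply: le_measure; rewrite ?inE.
rewrite !sumE//; apply: lee_nneseries => n _; first by move=> _; exact: integral_ge0.
apply: ge0_subset_integral => //.
apply: measurable_funTS; apply/measurable_EFinP.
by apply: measurable_funD => //; exact: measurable_powln.
Qed.

Lemma good_refine A : covers S AA Q A -> mass A < Phi + 1 ->
  exists A', [/\ good A', mass A' <= mass A,
    forall a, pow_sum a A' <= pow_sum a A &
    forall a, (0 < a < 1)%R -> powlog_sum a A' + (a^-1)%:E * mass A' <=
      powlog_sum a A + (a^-1)%:E * mass A].
Proof.
move=> cA mA; have [mB AE] := coversP S_inj cA.
pose B := disj S (pull S A : (set T)^nat).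
have mD : forall n, measurable (B n : set T) by exact: measurable_disj.
have BB n : B n `<=` pull S A n by exact: disj_sub.
have cD : covers S AA Q (iter_cover S B) by exact: covers_disj.
have pD : pull S (iter_cover S B) = B by exact: pull_iter_cover.
have mle : mass (iter_cover S B) <= mass A.
  rewrite /mass pD; apply: lee_nneseries => // n _.
  by apply: le_measure; rewrite ?inE//; exact: mB.
exists (iter_cover S B); split => //.
- split=> //; first exact: le_lt_trans mA.
  by rewrite pD; exact: nneseries_disj_le.
- move=> a; rewrite /pow_sum pD; apply: lee_nneseries => n _.
    by move=> _; apply: integral_ge0 => x _; exact: poweR_ge0.
  apply: ge0_subset_integral; [exact: mD|exact: mB| | |exact: BB].
    apply: measurable_funTS.
    exact: (measurableT_comp (measurable_poweR _)).
  by move=> x _; exact: poweR_ge0.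
- move=> a a01; rewrite /powlog_sum /mass pD; apply: powlog_sum_mono => //.
  exact: mass_lty mA.
Qed.

(** Bounds the integral of 1 + Z along any [good] cover: mass plus first moment. *)
Definition size_bound : R := (fine Phi + 1 + fine (Lambda setT))%R.

Lemma size_bound_ge0 : (0 <= size_bound)%R.
Proof.
rewrite /size_bound !addr_ge0// fine_ge0//.
by apply: le_ereal_inf_tmp => _ [B cB <-]; exact: mass_ge0.
Qed.

Lemma good_tsize A : good A -> (tsize phi0 Lambda (pull S A) <= size_bound)%R.
Proof.
move=> gA; have [_ _ loo] := good_tame gA; case: (gA) => cA mA lA.
apply: lerD.
  have : (rmass A <= fine Phi + 1)%R; last by [].
  by rewrite -lee_fin -massE// EFinD fineK ?Phi_fin_num// ltW.
rewrite -lee_fin !fineK//; first exact: fin_num_measure.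
by rewrite ge0_fin_numE//; exact: nneseries_ge0.
Qed.

Lemma rpow_tangent s t A : (0 < s < 1)%R -> (0 < t < 1)%R -> good A ->
  ((t - s) * rlog s A <= rpow t A - rpow s A)%R.
Proof.
move=> s01 t01 gA; have tA := good_tame gA.
have /andP[s0 s1] := s01; have /andP[t0 t1] := t01.
have dp a : (0 < a < 1)%R -> dominated (fun x => dens x `^ a)%R.
  by move=> /andP[? ?]; apply: dominated_powR => //; rewrite !ltW.
have ds := dp _ s01; have dt := dp _ t01.
have dl := dominated_powln Z_meas Z_ge0 s01.
have := Isum_le Z_meas Z_ge0 Z_density tA
  (dominated_lin (t - s) 0 dl dl) (dominated_lin 1 (-1) dt ds).
rewrite !(Isum_lin Z_meas Z_ge0 Z_density tA)// mul0r addr0 mul1r mulN1r.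
apply => x; rewrite mul0r addr0 mul1r mulN1r.
exact: powR_tangent_le (dens_ge0 Z_ge0 x) s0 t0.
Qed.

Lemma rlog_norm a s A : (0 < a)%R -> (a <= s <= 1 - a)%R -> good A ->
  (`|rlog s A| <= a^-1 * size_bound)%R.
Proof.
move=> a0 /andP[as_ sa] gA; have tA := good_tame gA.
have s01 : (0 < s < 1)%R by lra.
have dl := dominated_powln Z_meas Z_ge0 s01.
have := @Isum_norm_le _ _ _ phi0 Lambda _ Z_meas Z_ge0 Z_density _ tA
  _ a^-1 dl (fun x => norm_powR_ln_le (dens_ge0 Z_ge0 x) a0 as_ sa).
move=> /le_trans; apply; rewrite ler_wpM2l ?invr_ge0 ?(ltW a0)//.
exact: good_tsize.
Qed.

Lemma rlog_lip a s t A : (0 < a)%R -> (a <= s <= 1 - a)%R ->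
  (a <= t <= 1 - a)%R -> good A ->
  (`|rlog t A - rlog s A| <= 8 / a ^+ 2 * size_bound * `|t - s|)%R.
Proof.
move=> a0 /andP[as_ sa] /andP[at_ ta] gA; have tA := good_tame gA.
have s01 : (0 < s < 1)%R by lra.
have t01 : (0 < t < 1)%R by lra.
have ds := dominated_powln Z_meas Z_ge0 s01.
have dt := dominated_powln Z_meas Z_ge0 t01.
have := @Isum_norm_le _ _ _ phi0 Lambda _ Z_meas Z_ge0 Z_density _ tA
  _ (8 / a ^+ 2 * `|t - s|)%R (dominated_lin 1 (-1) dt ds).
rewrite !(Isum_lin Z_meas Z_ge0 Z_density tA)// mul1r mulN1r => h.
apply: (le_trans (h _)).
  move=> x; rewrite mul1r mulN1r.
  exact: powR_ln_lip (dens_ge0 Z_ge0 x) a0 as_ sa at_ ta.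
rewrite mulrAC ler_wpM2r// ler_wpM2l//; first by rewrite divr_ge0// exprn_ge0// ltW.
exact: good_tsize.
Qed.

(** * Finiteness of H and Psi, and reduction of their infima to good covers *)

Local Notation covers0 := (covers0 phi0 Q).
Local Notation covers1 := (covers1 phi0 Z Q).
Local Notation Heps := (Heps phi0 Z Q).
Local Notation Hlim := (Hlim phi0 Z Q).
Local Notation Psi1eps := (Psi1eps phi0 Z Q).
Local Notation Psi1 := (Psi1 phi0 Z Q).

Lemma Heps_antitone s (e e' : R) : (0 < e)%R -> (e <= e')%R ->
  Heps s e'%:E <= Heps s e%:E.
Proof.
move=> _ ee'; apply: ereal_inf_le_tmp => _ [A [cA mA] <-]; exists A => //.
by split=> //; apply: (lt_le_trans mA); rewrite leeD2l// lee_fin.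
Qed.

Lemma Psi1eps_antitone s t (e e' : R) : (0 < e)%R -> (e <= e')%R ->
  Psi1eps s t e'%:E <= Psi1eps s t e%:E.
Proof.
move=> _ ee'; apply: ereal_inf_le_tmp => _ [A [[cA mA] pA] <-]; exists A => //.
by split; first split=> //; apply: lt_le_trans;
  [exact: mA|rewrite leeD2l// lee_fin|exact: pA|rewrite leeD2l// lee_fin].
Qed.

Lemma rpow_bound s A : (0 <= s <= 1)%R -> good A ->
  (0 <= rpow s A <= size_bound)%R.
Proof.
move=> s01 gA; apply/andP; split.
  by rewrite -lee_fin -(pow_sumE s01 gA) pow_sum_ge0.
apply: le_trans (good_tsize gA); apply: (le_trans (ler_norm _)).
rewrite -[leRHS]mul1r; apply: (Isum_norm_le Z_meas Z_ge0 Z_density).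
- exact: good_tame.
- exact: dominated_powR.
- move=> x; rewrite mul1r ger0_norm ?powR_ge0// powR_le1D//.
  exact: dens_ge0.
Qed.

Lemma good_covers0 (e : R) : (0 < e <= 1)%R ->
  exists2 A, good A & covers0 e%:E A.
Proof.
move=> /andP[e0 e1].
have : Phi < Phi + e%:E.
  by rewrite -(fineK Phi_fin_num) -EFinD lte_fin ltrDl.
move=> /ereal_inf_lt[_ [A cA <-] mA].
have mA1 : mass A < Phi + 1 by apply: (lt_le_trans mA); rewrite leeD2l ?lee_fin.
have [A' [gA' mA' _ _]] := good_refine cA mA1.
by exists A' => //; split; [case: gA'|exact: le_lt_trans mA].
Qed.

Lemma Heps_bound s (e : R) : (0 <= s <= 1)%R -> (0 < e)%R ->
  0 <= Heps s e%:E <= size_bound%:E.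
Proof.
move=> s01 e0; apply/andP; split.
  by apply: le_ereal_inf_tmp => _ [A _ <-]; exact: pow_sum_ge0.
have m0 : (0 < Order.min e 1)%R by rewrite lt_min e0 ltr01.
apply: (@le_trans _ _ (Heps s (Order.min e 1)%R%:E)).
  by apply: Heps_antitone => //; rewrite ge_min lexx.
have [|A gA cA] := @good_covers0 (Order.min e 1)%R.
  by rewrite m0 ge_min lexx orbT.
apply: (@le_trans _ _ (pow_sum s A)).
  by apply: ereal_inf_lbound; exists A.
by rewrite (pow_sumE s01 gA) lee_fin; have /andP[] := rpow_bound s01 gA.
Qed.

Lemma Heps_fin_num s (e : R) : (0 <= s <= 1)%R -> (0 < e)%R ->
  Heps s e%:E \is a fin_num.
Proof.
move=> s01 e0; have /andP[h1 h2] := Heps_bound s01 e0.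
by rewrite ge0_fin_numE// (le_lt_trans h2)// ltry.
Qed.

Lemma Heps_Hlim s (e : R) : (0 < e)%R -> Heps s e%:E <= Hlim s.
Proof.
have [h _] := lim_at_right_antitone (fun e e' => @Heps_antitone s e e').
exact: h.
Qed.

Lemma Hlim_fin_num s : (0 <= s <= 1)%R -> Hlim s \is a fin_num.
Proof.
move=> s01; rewrite ge0_fin_numE; last first.
  by have /andP[h _] := Heps_bound s01 ltr01; apply: (le_trans h); exact: Heps_Hlim.
apply: (@le_lt_trans _ _ size_bound%:E); last exact: ltry.
rewrite leNgt; apply/negP => lt.
have [_ /(_ _ lt)[e /andP[e0 _] /(_ e)]] :=
  lim_at_right_antitone (fun e e' => @Heps_antitone s e e').
rewrite e0 lexx => /(_ isT); apply/negP; rewrite -leNgt.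
by have /andP[] := Heps_bound s01 e0.
Qed.

Local Notation H := (fun s => fine (Hlim s)).
Local Notation near_opt := (near_opt good (rmass) rpow (fine Phi) H).

Lemma covers1_goodE s (e : R) A : (0 < s < 1)%R -> good A ->
  covers1 s e%:E A <-> near_opt s e A.
Proof.
move=> /andP[s0 s1] gA; have s01 : (0 <= s <= 1)%R by rewrite !ltW.
rewrite /Defs.covers1 /Defs.covers0 /= (pow_sumE s01 gA) (massE gA).
rewrite -(fineK Phi_fin_num) -(fineK (Hlim_fin_num s01)) -!EFinD !lte_fin.
by split=> [[[_ ?] ?]|[_ ? ?]]; split => //; split=> //; case: gA.
Qed.

(** Near-minimality of the mass makes disjointification cheap: A has mass below Phi + e and the
    refined cover at least Phi, so less than e is removed and [powlog_sum] rises by at most e /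
    b. *)
Lemma covers1_refine s (e : R) A : (0 < e <= 1)%R -> covers1 s e%:E A ->
  exists A', [/\ good A', covers1 s e%:E A' &
    forall b, (0 < b < 1)%R ->
      powlog_sum b A' <= powlog_sum b A + (b^-1 * e)%:E].
Proof.
move=> /andP[e0 e1] [[cA mA] pA].
have mA1 : mass A < Phi + 1 by apply: (lt_le_trans mA); rewrite leeD2l ?lee_fin.
have [A' [gA' mA' pA' lA']] := good_refine cA mA1.
exists A'; split=> //.
  split; last exact: le_lt_trans (pA' s) pA.
  by split; [case: gA'|exact: le_lt_trans mA' mA].
move=> b b01; have /andP[b0 _] := b01; have := lA' b b01.
have PA' : Phi <= mass A' by apply: ereal_inf_lbound; exists A' => //; case: gA'.
have mAf : mass A \is a fin_num.
  by rewrite ge0_fin_numE ?(mass_ge0 cA)//; exact: mass_lty mA1.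
rewrite (massE gA') (powlog_sumE b01 gA').
rewrite -(fineK mAf) -EFinM -EFinM.
have h : (fine (mass A) - rmass A' <= e)%R.
  rewrite -lee_fin EFinB fineK// -(massE gA') leeBlDl ?(massE gA')//.
  apply: (le_trans (ltW mA)); rewrite leeD2r// -(massE gA')//.
have ib : (0 <= b^-1)%R by rewrite invr_ge0 ltW.
have h' : (b^-1 * (fine (mass A) - rmass A') <= b^-1 * e)%R.
  by rewrite ler_wpM2l.
move=> h2; rewrite -leeBlDr//; rewrite -leeBlDr// in h2.
apply: le_trans h2; rewrite -!EFinN -!EFinD lee_fin; lra.
Qed.

Lemma covers1_good_ex s (e : R) : (0 < s < 1)%R -> (0 < e <= 1)%R ->
  exists2 A, good A & covers1 s e%:E A.
Proof.
move=> /andP[s0 s1] e01; have s01 : (0 <= s <= 1)%R by rewrite !ltW.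
have /andP[e0 e1] := e01.
have : Heps s e%:E < Hlim s + e%:E.
  apply: (le_lt_trans (Heps_Hlim s e0)).
  by rewrite -(fineK (Hlim_fin_num s01)) -EFinD lte_fin ltrDl.
move=> /ereal_inf_lt[_ [A cA <-] pA].
have [A' [gA' cA' _]] := covers1_refine e01 (conj cA pA).
by exists A'.
Qed.

Lemma Psi1eps_le b s (e : R) A : (0 < b < 1)%R -> good A -> covers1 s e%:E A ->
  Psi1eps b s e%:E <= (rlog b A)%:E.
Proof.
move=> b01 gA cA; rewrite -(powlog_sumE b01 gA).
by apply: ereal_inf_lbound; exists A.
Qed.

Lemma Psi1eps_bound a b s (e : R) : (0 < a)%R -> (a <= b <= 1 - a)%R ->
  (0 < s < 1)%R -> (0 < e <= 1)%R ->
  (- (a^-1 * (size_bound + 1)))%:E <= Psi1eps b s e%:E <=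
    (a^-1 * (size_bound + 1))%:E.
Proof.
move=> a0 ab s01 e01; have /andP[ab1 ab2] := ab.
have ia : (0 < a^-1)%R by rewrite invr_gt0.
have b01 : (0 < b < 1)%R by lra.
apply/andP; split.
  apply: le_ereal_inf_tmp => _ [A cA <-].
  have [A' [gA' cA' lA']] := covers1_refine e01 cA.
  have := lA' _ b01; rewrite (powlog_sumE b01 gA') -leeBlDr// => lA.
  apply: le_trans lA; rewrite -EFinB lee_fin.
  have := rlog_norm a0 ab gA' => /ler_normlP[h _].
  have ibe : (b^-1 * e <= a^-1)%R.
    rewrite -[leRHS]mulr1; apply: ler_pM; rewrite ?invr_ge0; try lra.
    by rewrite lef_pV2 ?posrE//; lra.
  nra.
have [A gA cA] := covers1_good_ex s01 e01.
apply: (le_trans (Psi1eps_le b01 gA cA)); rewrite lee_fin.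
have := rlog_norm a0 ab gA => /ler_normlP[_ h]; nra.
Qed.

Lemma Psi1eps_fin_num b s (e : R) : (0 < b < 1)%R ->
  (0 < s < 1)%R -> (0 < e <= 1)%R -> Psi1eps b s e%:E \is a fin_num.
Proof.
move=> b01 s01 e01; have /andP[b0 b1] := b01.
have m0 : (0 < Order.min b (1 - b))%R by rewrite lt_min b0 subr_gt0.
have /andP[h1 h2] := @Psi1eps_bound _ b s e m0
  ltac:(by rewrite ge_min lexx/= lerBrDl -lerBrDr ge_min lexx orbT) s01 e01.
by rewrite fin_numE -ltNye -ltey (le_lt_trans h2) ?ltry// (lt_le_trans _ h1) ?ltNyr.
Qed.

Lemma Psi1eps_adherent b s (e : R) : (0 < b < 1)%R ->
  (0 < s < 1)%R -> (0 < e <= 1)%R ->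
  exists2 A, good A /\ covers1 s e%:E A &
    (rlog b A < fine (Psi1eps b s e%:E) + (b^-1 + 1) * e)%R.
Proof.
move=> b01 s01 e01; have /andP[e0 e1] := e01.
have Pf := Psi1eps_fin_num b01 s01 e01.
have := lb_ereal_inf_adherent e0 Pf => -[_ [A cA <-] lA].
have [A' [gA' cA' lA']] := covers1_refine e01 cA.
exists A' => //; have := lA' _ b01; rewrite (powlog_sumE b01 gA').
rewrite -leeBlDr// => /le_lt_trans/(_ lA).
rewrite -[ereal_inf _](fineK Pf) -EFinB -EFinD lte_fin; lra.
Qed.

Lemma Psi1eps_Psi1 s t (e : R) : (0 < e)%R -> Psi1eps s t e%:E <= Psi1 s t.
Proof.
have [h _] := lim_at_right_antitone (fun e e' => @Psi1eps_antitone s t e e').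
exact: h.
Qed.

Lemma Psi1_bound a b s : (0 < a)%R -> (a <= b <= 1 - a)%R -> (0 < s < 1)%R ->
  (- (a^-1 * (size_bound + 1)))%:E <= Psi1 b s <= (a^-1 * (size_bound + 1))%:E.
Proof.
move=> a0 ab s01; apply/andP; split.
  have /andP[h _] := Psi1eps_bound a0 ab s01 (e := 1%R) ltac:(by rewrite ltr01 lexx).
  by apply: (le_trans h); exact: Psi1eps_Psi1.
rewrite leNgt; apply/negP => lt.
have [_ /(_ _ lt)[e /andP[e0 e1] /(_ e)]] :=
  lim_at_right_antitone (fun e e' => @Psi1eps_antitone b s e e').
rewrite e0 lexx => /(_ isT); apply/negP; rewrite -leNgt.
by have /andP[] := Psi1eps_bound a0 ab s01 (e := e) ltac:(by rewrite e0 e1).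
Qed.

Lemma Psi1_fin_num b s : (0 < b < 1)%R -> (0 < s < 1)%R -> Psi1 b s \is a fin_num.
Proof.
move=> b01 s01; have /andP[b0 b1] := b01.
have m0 : (0 < Order.min b (1 - b))%R by rewrite lt_min b0 subr_gt0.
have /andP[h1 h2] := @Psi1_bound _ b s m0
  ltac:(by rewrite ge_min lexx/= lerBrDl -lerBrDr ge_min lexx orbT) s01.
by rewrite fin_numE -ltNye -ltey (le_lt_trans h2) ?ltry// (lt_le_trans _ h1) ?ltNyr.
Qed.

(** * Covers as an instance of the abstract optimization problem *)

Local Notation h := (fun s e => fine (Heps s e%:E)).
Local Notation psi := (fun u s e => fine (Psi1eps u s e%:E)).
Local Notation Psi := (fun s => fine (Psi1 s s)).
Local Notation delta := (delta phi0 Z Q).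
Local Notation eps_tau := (eps_tau phi0 Z Q).

Local Notation family a K := (near_opt_family good rmass rpow rlog (fine Phi)
  H h psi Psi (fun s => a <= s <= 1 - a)%R K).

Lemma covers_family a : (0 < a)%R ->
  family a (1 + a^-1 * (size_bound + 1) + 8 / a ^+ 2 * size_bound + (a^-1 + 1))%R.
Proof.
(* K adds up the constants for K >= 1, for the bounds on slopes and Psi, for the Lipschitz estimate,
   and for adherence, where e comes from the infimum and e / u from the refinement. *)
move=> a0; set K := (_ + (a^-1 + 1))%R.
have ia : (0 < a^-1)%R by rewrite invr_gt0.
have V0 := size_bound_ge0.
have k1 : (0 <= a^-1 * size_bound)%R by rewrite mulr_ge0// ltW.
have k2 : (0 <= 8 / a ^+ 2 * size_bound)%R.
  by rewrite mulr_ge0// divr_ge0// exprn_ge0// ltW.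
have K1 : (a^-1 * (size_bound + 1) <= K)%R by rewrite /K; lra.
have K2 : (8 / a ^+ 2 * size_bound <= K)%R by rewrite /K mulrDr; lra.
have K3 : (a^-1 + 1 <= K)%R by rewrite /K mulrDr; lra.
have J01 s : (a <= s <= 1 - a)%R -> (0 < s < 1)%R by move=> /andP[? ?]; lra.
have J01' s : (a <= s <= 1 - a)%R -> (0 <= s <= 1)%R by move=> /andP[? ?]; lra.
split.
- by move=> s t /andP[? ?] /andP[? ?]; rewrite ler_norml; apply/andP; split; lra.
- by rewrite /K mulrDr; lra.
- by move=> s t A /J01 s01 /J01 t01; exact: rpow_tangent.
- move=> s A Js gA; apply: (le_trans (rlog_norm a0 Js gA)).
  by apply: le_trans K1; rewrite ler_wpM2l ?(ltW ia)//; lra.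
- move=> s t A Js Jt gA; apply: (le_trans (rlog_lip a0 Js Jt gA)).
  by rewrite ler_wpM2r.
- move=> s e A Js /andP[e0 e1] gA mA.
  rewrite -lee_fin fineK; last exact: Heps_fin_num (J01' _ Js) e0.
  rewrite -(pow_sumE (J01' _ Js) gA); apply: ereal_inf_lbound; exists A => //.
  split; first by case: gA.
  by rewrite (massE gA) -(fineK Phi_fin_num) -EFinD lte_fin.
- move=> s d Js d0; have Hf := Hlim_fin_num (J01' _ Js).
  have [_ /(_ (fine (Hlim s) - d)%:E)[|e e01 he]] :=
    lim_at_right_antitone (fun e e' => @Heps_antitone s e e').
    by rewrite -[ltRHS](fineK Hf) lte_fin ltrBlDr ltrDl.
  exists e => // e' e'e; have := he e' e'e; have /andP[e'0 _] := e'e.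
  by rewrite -(fineK (Heps_fin_num (J01' _ Js) e'0)) lte_fin.
- move=> u s e A Ju Js e01 nA; have gA : good A by case: nA.
  have cA : covers1 s e%:E A by apply/(covers1_goodE _ (J01 _ Js) gA).
  rewrite -lee_fin fineK; last exact: Psi1eps_fin_num (J01 _ Ju) (J01 _ Js) e01.
  exact: Psi1eps_le (J01 _ Ju) gA cA.
- move=> u s e Ju Js e01; have /andP[u0 u1] := Ju; have /andP[e0 e1] := e01.
  have [A [gA cA] lA] := Psi1eps_adherent (J01 _ Ju) (J01 _ Js) e01.
  exists A; first by apply/(covers1_goodE _ (J01 _ Js) gA).
  apply: (lt_le_trans lA); rewrite lerD2l ler_wpM2r ?(ltW e0)//.
  apply: le_trans K3; rewrite lerD2r lef_pV2 ?posrE//; lra.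
- move=> s e Js e01; have /andP[e0 _] := e01.
  rewrite -lee_fin !fineK; first exact: Psi1eps_Psi1.
    exact: Psi1_fin_num (J01 _ Js) (J01 _ Js).
  exact: Psi1eps_fin_num (J01 _ Js) (J01 _ Js) e01.
- move=> s d Js d0; have Pf := Psi1_fin_num (J01 _ Js) (J01 _ Js).
  have [_ /(_ (fine (Psi1 s s) - d)%:E)[|e e01 he]] :=
    lim_at_right_antitone (fun e e' => @Psi1eps_antitone s s e e').
    by rewrite -[ltRHS](fineK Pf) lte_fin ltrBlDr ltrDl.
  exists e => // e' e'e; have := he e' e'e; have /andP[e'0 e'1] := e'e.
  rewrite -[X in _ < X -> _]fineK ?lte_fin//.
  apply: Psi1eps_fin_num (J01 _ Js) (J01 _ Js) _.
  by rewrite e'0 (le_trans e'1)//; case/andP: e01.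
- move=> s Js; have Pf := Psi1_fin_num (J01 _ Js) (J01 _ Js).
  have := Psi1_bound a0 Js (J01 _ Js); rewrite -(fineK Pf) !lee_fin => /andP[h1 h2].
  by apply: le_trans K1; rewrite ler_norml h1 h2.
Qed.

Lemma local_family t : (0 < t < 1)%R -> exists a K : R,
  [/\ (0 < a)%R, family a K & forall s, (`|t - s| < a)%R ->
    [/\ (a <= s <= 1 - a)%R, (a <= t <= 1 - a)%R & (0 < s < 1)%R]].
Proof.
(* Half the distance b from t to the endpoints serves both as margin a and as size of the window
   around t. *)
move=> /andP[t0 t1]; pose b := (Order.min t (1 - t))%R.
have b0 : (0 < b)%R by rewrite /b lt_min t0 subr_gt0.
have bt : (b <= t)%R by rewrite /b ge_min lexx.
have bt' : (b <= 1 - t)%R by rewrite /b ge_min lexx orbT.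
have a0 : (0 < b / 2)%R by rewrite divr_gt0.
exists (b / 2)%R; eexists; split; [exact: a0|exact: covers_family a0|].
move=> s; rewrite ltr_norml => /andP[? ?].
by split; apply/andP; split; lra.
Qed.

(** * The radii delta_tau and eps_tau *)

Lemma deltaP tau s t : (0 < tau)%R -> (0 < s < 1)%R -> (0 < t < 1)%R -> s != t ->
  let r := (`|s - t| `^ tau)%R in let e := delta tau s t in
  [/\ (0 < e <= r)%R, (H s - r < h s e)%R & (H t - r < h t e)%R].
Proof.
move=> tau0 /andP[s0 s1] /andP[t0 t1] st r e.
have s01 : (0 <= s <= 1)%R by rewrite !ltW.
have t01 : (0 <= t <= 1)%R by rewrite !ltW.
have st0 : (0 < `|s - t|)%R by rewrite normr_gt0 subr_eq0.
have st1 : (`|s - t| < 1)%R by rewrite ltr_norml; apply/andP; split; lra.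
pose q := (`|s - t| `^ (tau / 2))%R.
have q0 : (0 < q)%R by exact: powR_gt0.
have q1 : (q < 1)%R.
  rewrite -(powRr0 `|s - t|%R) /q /powR !gt_eqF// ltr_expR mul0r.
  by rewrite nmulr_llt0 ?divr_gt0// ln_lt0// st0.
have qr : (q * q = r)%R.
  rewrite /q /r -powRD; last by apply/implyP => _; rewrite gt_eqF.
  by congr (_ `^ _)%R; rewrite -splitr.
have r0 : (0 < r)%R by exact: powR_gt0.
pose E := [set d : R | (0 < d < q)%R /\
  (Hlim s - r%:E < Heps s d%:E)%E /\ (Hlim t - r%:E < Heps t d%:E)%E].
have eE : e = (q * sup E)%R by [].
have near_H u : (0 <= u <= 1)%R -> exists2 e0 : R, (0 < e0 <= 1)%R &
    forall e, (0 < e <= e0)%R -> Hlim u - r%:E < Heps u e%:E.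
  move=> u01; have Hf := Hlim_fin_num u01.
  have lt : Hlim u - r%:E < Hlim u.
    by rewrite -(fineK Hf) -EFinB lte_fin ltrBlDr ltrDl.
  have [_ /(_ _ lt)] := lim_at_right_antitone (fun e e' => @Heps_antitone u e e').
  exact.
have [e1 /andP[e10 _] he1] := near_H s s01.
have [e2 /andP[e20 _] he2] := near_H t t01.
have [d [d0 Ed]] : exists d, (0 < d)%R /\ E d.
  pose d := Order.min (q / 2)%R (Order.min e1 e2).
  have d0 : (0 < d)%R by rewrite /d lt_min divr_gt0// lt_min e10 e20.
  have dq : (d < q)%R by rewrite /d gt_min; apply/orP; left; lra.
  exists d; split => //; split; [by rewrite d0 dq|split].
    by apply: he1; rewrite d0 /d ge_min [X in _ || X]ge_min lexx ?orbT.
  by apply: he2; rewrite d0 /d ge_min [X in _ || X]ge_min lexx ?orbT.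
have Eub : ubound E q by move=> x [/andP[_ /ltW]].
have hsE : has_sup E by split; [exists d|exists q].
have supq : (sup E <= q)%R by apply: ge_sup => //; exists d.
have sup0 : (0 < sup E)%R by apply: (lt_le_trans d0); apply: ub_le_sup => //; exists q.
have e0 : (0 < e)%R by rewrite eE mulr_gt0.
(* The supremum need not belong to E. The factor q < 1 puts e strictly below it, so some x in E
   exceeds e, and antitonicity of [Heps] carries the conditions from x to e. The same factor with
   [sup E <= q] gives e <= q * q = r. *)
have esup : (e < sup E)%R by rewrite eE gtr_pMl.
have [x Ex ex] := sup_gt (ex_intro _ d Ed) esup.
have HE u : (0 <= u <= 1)%R -> Hlim u - r%:E < Heps u x%:E ->
    (fine (Hlim u) - r < fine (Heps u e%:E))%R.
  move=> u01 hx; rewrite -lte_fin EFinB (fineK (Hlim_fin_num u01)).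
  rewrite (fineK (Heps_fin_num u01 e0)); apply: (lt_le_trans hx).
  by apply: Heps_antitone => //; exact: ltW.
case: Ex => _ [hxs hxt].
split; [|exact: (HE s s01 hxs)|exact: (HE t t01 hxt)].
apply/andP; split; first exact: e0.
by rewrite eE -qr; apply: ler_wpM2l => //; exact: ltW.
Qed.

Lemma eps_tauE tau s t : (0 < tau)%R -> (0 < s < 1)%R -> (0 < t < 1)%R ->
  (s < t)%R ->
  eps_tau tau s t =
    (radius psi s t (delta tau s t) ((t - s) `^ tau))%:E.
Proof.
move=> tau0 s01 t01 st; have sn : s != t by rewrite lt_eqF.
have [/andP[e0 er] _ _] := deltaP tau0 s01 t01 sn.
have e01 : (0 < delta tau s t <= 1)%R.
  rewrite e0 (le_trans er)//; have /andP[s0 s1] := s01; have /andP[t0 t1] := t01.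
  have : (`|s - t| <= 1)%R by rewrite ler_norml; apply/andP; split; lra.
  have n0 : (0 < `|s - t|)%R by rewrite normr_gt0 subr_eq0.
  move=> n1; rewrite -[leRHS](powRr0 `|s - t|%R).
  by apply: ger_powR; [rewrite n0|exact: ltW].
rewrite /Defs.eps_tau /radius.
rewrite -(fineK (Psi1eps_fin_num t01 s01 e01)) -(fineK (Psi1eps_fin_num s01 t01 e01)).
by rewrite -EFinB -EFinM -!EFinD.
Qed.

Lemma Hlim_fin_num01 s : (0 < s < 1)%R -> Hlim s \is a fin_num.
Proof. by move=> /andP[s0 s1]; apply: Hlim_fin_num; rewrite !ltW. Qed.

(** * One-sided limits and lower limits *)

Lemma at_right_local t d : (0 < t < 1)%R -> (0 < d)%R ->
  \forall s \near t^'+, [/\ (0 < s < 1)%R,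
    (`|Psi t - (H s - H t) / (s - t)| < d)%R & (`|Psi t - Psi s| < d)%R].
Proof.
move=> t01 d0; have [a [K [a0 fam Ja]]] := local_family t01.
have Jt : (a <= t <= 1 - a)%R by case: (Ja t) => //; rewrite subrr normr0.
have [q q0 Pq] := slope_right_lim fam Jt d0.
apply: at_rightW; exists (Order.min a q); first by rewrite lt_min a0 q0.
move=> s ts; rewrite lt_min => /andP[sa sq].
have nts : (`|t - s| = s - t)%R by rewrite distrC gtr0_norm ?subr_gt0.
have [Js _ s01] := Ja s ltac:(by rewrite nts).
by have [? ?] := Pq s Js ts sq.
Qed.

Lemma Hlim_slope_right t : (0 < t < 1)%R ->
  diff_quot Hlim t s @[s --> t^'+] --> Psi1 t t.
Proof.
move=> t01; rewrite -[Psi1 t t](fineK (Psi1_fin_num t01 t01)).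
apply: cvg_EFin_dist => d d0.
apply: filterS (at_right_local t01 d0) => s [s01 Hd _].
by eexists; last exact: Hd; apply: diff_quotE; exact: Hlim_fin_num01.
Qed.

Lemma Psi1_right t : (0 < t < 1)%R ->
  Psi1 s s @[s --> t^'+] --> Psi1 t t.
Proof.
move=> t01; rewrite -[Psi1 t t](fineK (Psi1_fin_num t01 t01)).
apply: cvg_EFin_dist => d d0.
apply: filterS (at_right_local t01 d0) => s [s01 _ Pd].
by exists (Psi s) => //; rewrite fineK// Psi1_fin_num.
Qed.

(** F selects the exponent of the logarithmic integrand, s or t, so that both left-hand limits come
    from one argument. *)
Lemma Psi1eps_radius_left (F : R -> R -> R) tau t : (0 < t < 1)%R -> (0 < tau)%R ->
  (forall s, (s < t)%R -> F s t = s \/ F s t = t) ->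
  Psi1eps (F s t) s (eps_tau tau s t) @[s --> t^'-] --> Psi1 t t.
Proof.
move=> t01 tau0 Fst; rewrite -[Psi1 t t](fineK (Psi1_fin_num t01 t01)).
have [a [K [a0 fam Ja]]] := local_family t01.
apply: cvg_EFin_dist => d d0.
have Jt : (a <= t <= 1 - a)%R by case: (Ja t) => //; rewrite subrr normr0.
have K0 := K_gt0 fam.
have [q q0 Pq] := psi_radius_lim fam Jt d0.
have [q' q'0 Pq'] := powR_small tau0 q0.
apply: at_leftW; exists (Order.min a (Order.min q q')).
  by rewrite lt_min a0 lt_min q0 q'0.
move=> s st; rewrite lt_min => /andP[sa]; rewrite lt_min => /andP[sq sq'].
have ts0 : (0 < t - s)%R by rewrite subr_gt0.
have nts : (`|t - s| = t - s)%R by rewrite gtr0_norm.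
have [Js _ s01] := Ja s ltac:(by rewrite nts).
rewrite (eps_tauE tau0 s01 t01 st).
have := deltaP tau0 s01 t01 (negbT (lt_eqF st)).
rewrite distrC nts => -[er hs ht].
have JF : (a <= F s t <= 1 - a)%R by case: (Fst s st) => ->.
have Ft : (`|F s t - t| <= `|t - s|)%R.
  by case: (Fst s st) => ->; [rewrite distrC|rewrite subrr normr0].
have [rad01 raddist] := Pq _ _ _ _ Js JF st Ft sq er (Pq' _ ts0 sq') ht hs.
eexists; last exact: raddist.
have F01 : (0 < F s t < 1)%R by case: (Fst s st) => ->.
by rewrite fineK// Psi1eps_fin_num.
Qed.

Lemma slope_left_liminf_ge t : (0 < t < 1)%R ->
  Psi1 t t <= limf_einf (fun s => diff_quot Hlim t s) t^'-.
Proof.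
move=> t01; apply: limf_einf_ge => d d0.
have [a [K [a0 fam Ja]]] := local_family t01.
have Jt : (a <= t <= 1 - a)%R by case: (Ja t) => //; rewrite subrr normr0.
have [q q0 Pq] := slope_left_ge fam Jt d0.
apply: at_leftW; exists (Order.min a q); first by rewrite lt_min a0 q0.
move=> s st; rewrite lt_min => /andP[sa sq].
have nts : (`|t - s| = t - s)%R by rewrite gtr0_norm ?subr_gt0.
have [Js _ s01] := Ja s ltac:(by rewrite nts).
rewrite (diff_quotE (Hlim_fin_num01 t01) (Hlim_fin_num01 s01)).
rewrite -[Psi1 t t](fineK (Psi1_fin_num t01 t01)) -EFinD lee_fin.
exact: Pq.
Qed.

Lemma delta_small tau t q : (0 < t < 1)%R -> (0 < tau)%R -> (0 < q)%R ->
  \forall s \near t^'-, (0 < delta tau s t < q)%R.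
Proof.
move=> t01 tau0 q0; have [a [K [a0 fam Ja]]] := local_family t01.
have [q' q'0 Pq'] := powR_small tau0 q0.
apply: at_leftW; exists (Order.min a q'); first by rewrite lt_min a0 q'0.
move=> s st; rewrite lt_min => /andP[sa sq].
have ts0 : (0 < t - s)%R by rewrite subr_gt0.
have nts : (`|t - s| = t - s)%R by rewrite gtr0_norm.
have [_ _ s01] := Ja s ltac:(by rewrite nts).
have := deltaP tau0 s01 t01 (negbT (lt_eqF st)).
rewrite distrC nts => -[/andP[e0 er] _ _].
by rewrite e0 (le_lt_trans er)// Pq'.
Qed.

Lemma Psi1eps_delta_swap tau t d (F G : R -> R) :
  (0 < t < 1)%R -> (0 < tau)%R -> (0 < d)%R ->
  (forall s, F s = s \/ F s = t) -> (forall s, G s = s \/ G s = t) ->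
  \forall s \near t^'-, Psi1eps (F s) s (delta tau s t)%:E <=
    Psi1eps (G s) s (delta tau s t)%:E + d%:E.
Proof.
move=> t01 tau0 d0 Fst Gst; have [a [K [a0 fam Ja]]] := local_family t01.
have [q q0 Pq] := psi_swap_le fam d0.
have m0 : (0 < Order.min q 1)%R by rewrite lt_min q0 ltr01.
have : \forall s \near t^'-, [/\ (`|t - s| < q)%R, (a <= s <= 1 - a)%R,
    (a <= t <= 1 - a)%R & (0 < s < 1)%R].
  apply: at_leftW; exists (Order.min a q); first by rewrite lt_min a0 q0.
  move=> s st; rewrite lt_min => /andP[sa sq].
  have nts : (`|t - s| = t - s)%R by rewrite gtr0_norm ?subr_gt0.
  by have [? ? ?] := Ja s ltac:(by rewrite nts); rewrite nts.
apply: filterS2 (delta_small t01 tau0 m0) => s /andP[e0].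
rewrite lt_min => /andP[eq e1] [tsq Js Jt s01].
have e01 : (0 < delta tau s t <= 1)%R by rewrite e0 ltW.
have inJ (E : R -> R) : E s = s \/ E s = t ->
  (a <= E s <= 1 - a)%R /\ (0 < E s < 1)%R by case=> ->.
have [JF F01] := inJ F (Fst s); have [JG G01] := inJ G (Gst s).
rewrite -(fineK (Psi1eps_fin_num F01 s01 e01)).
rewrite -(fineK (Psi1eps_fin_num G01 s01 e01)) -EFinD lee_fin.
apply: Pq => //; last by rewrite e0.
by case: (Fst s) => ->; case: (Gst s) => ->; rewrite ?subrr ?normr0// distrC.
Qed.

Lemma slope_left_liminf_le tau t : (0 < t < 1)%R -> (1 < tau)%R ->
  limf_einf (fun s => diff_quot Hlim t s) t^'- <=
  limf_einf (fun s => Psi1eps t s (delta tau s t)%:E) t^'-.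
Proof.
move=> t01 tau1; apply: limf_einf_le => d d0.
have tau0 : (0 < tau)%R by exact: lt_trans tau1.
have tau10 : (0 < tau - 1)%R by rewrite subr_gt0.
have [a [K [a0 fam Ja]]] := local_family t01.
have Jt : (a <= t <= 1 - a)%R by case: (Ja t) => //; rewrite subrr normr0.
have [q q0 Pq] := slope_left_le fam Jt d0.
have [q' q'0 Pq'] := powR_small tau10 q0.
have : \forall s \near t^'-, [/\ (s < t)%R, (t - s < q')%R,
    (a <= s <= 1 - a)%R & (0 < s < 1)%R].
  apply: at_leftW; exists (Order.min a q'); first by rewrite lt_min a0 q'0.
  move=> s st; rewrite lt_min => /andP[sa sq].
  have nts : (`|t - s| = t - s)%R by rewrite gtr0_norm ?subr_gt0.
  by have [? ? ?] := Ja s ltac:(by rewrite nts).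
apply: filterS2 (delta_small t01 tau0 ltr01) => s /andP[e0 e1] [st sq Js s01].
have ts0 : (0 < t - s)%R by rewrite subr_gt0.
have nts : (`|t - s| = t - s)%R by rewrite gtr0_norm.
have e01 : (0 < delta tau s t <= 1)%R by rewrite e0 ltW.
have := deltaP tau0 s01 t01 (negbT (lt_eqF st)).
rewrite distrC nts => -[er _ ht].
rewrite (diff_quotE (Hlim_fin_num01 t01) (Hlim_fin_num01 s01)).
rewrite -(fineK (Psi1eps_fin_num t01 s01 e01)) -EFinD lee_fin.
apply: (Pq _ _ _ Js st er _ _ ht).
  (* Here tau > 1 enters: (t - s)^tau is t - s times (t - s)^(tau - 1), and the second factor tends
     to 0. *)
  rewrite -(mulr_powRB1 (ltW ts0) tau0) mulrC ltr_pM2r//.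
  exact: Pq'.
by case/andP: s01 => s0 _; case/andP: t01 => _ t1; rewrite ltrBlDr (lt_trans t1)// ltrDl.
Qed.

Lemma Psi1eps_left_liminf tau t : (0 < t < 1)%R -> (0 < tau)%R ->
  limf_einf (fun s => Psi1eps t s (delta tau s t)%:E) t^'- =
  limf_einf (fun s => Psi1eps s s (delta tau s t)%:E) t^'-.
Proof.
move=> t01 tau0; apply/eqP; rewrite eq_le; apply/andP; split.
  apply: limf_einf_le => d d0.
  by apply: (@Psi1eps_delta_swap _ _ _ (fun=> t) id) => // s; [right|left].
apply: limf_einf_le => d d0.
by apply: (@Psi1eps_delta_swap _ _ _ id (fun=> t)) => // s; [left|right].
Qed.

End good_covers.

Theorem theorem5 (R : realType) (X : pointedType) (S : X -> X)
  (AA : set (set X))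
  (phi0 Lambda : {finite_measure set (space0 S AA) -> \bar R})
  (Z : space0 S AA -> \bar R) (Q : set X)
  (S_bij : bijective S)
  (AA_sigma : sigma_algebra [set: X] AA)
  (Lambda_inv : forall A : set (space0 S AA),
     measurable A -> Lambda (S @^-1` A) = Lambda A)
  (Lambda_ac : Lambda `<< phi0)
  (Z_meas : measurable_fun setT Z)
  (Z_ge0 : forall x, 0 <= Z x)
  (Z_density : forall A : set (space0 S AA),
     measurable A -> Lambda A = \int[phi0]_(x in A) Z x)
  (Q_meas : <<s genZ S AA >> Q) :
  (forall alpha0 : R, (0 < alpha0 < 1)%R ->
     [/\ right_derivable (fun alpha => Hlim phi0 Z Q alpha) alpha0,
         right_derive (fun alpha => Hlim phi0 Z Q alpha) alpha0
           = Psi1 phi0 Z Q alpha0 alpha0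
       & Psi1 phi0 Z Q alpha alpha @[alpha --> alpha0^'+]
           --> Psi1 phi0 Z Q alpha0 alpha0])
  /\
  (forall alpha tau : R, (0 < alpha < 1)%R -> (0 < tau)%R ->
     (Psi1eps phi0 Z Q alpha0 alpha0 (eps_tau phi0 Z Q tau alpha0 alpha)
        @[alpha0 --> alpha^'-] --> Psi1 phi0 Z Q alpha alpha)
     /\
     (Psi1eps phi0 Z Q alpha alpha0 (eps_tau phi0 Z Q tau alpha0 alpha)
        @[alpha0 --> alpha^'-] --> Psi1 phi0 Z Q alpha alpha))
  /\
  (forall alpha tau : R, (0 < alpha < 1)%R -> (1 < tau)%R ->
     [/\ Psi1 phi0 Z Q alpha alpha
           <= limf_einf (fun alpha0 => diff_quot (Hlim phi0 Z Q) alpha alpha0)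
                alpha^'-,
         limf_einf (fun alpha0 => diff_quot (Hlim phi0 Z Q) alpha alpha0) alpha^'-
           <= limf_einf (fun alpha0 => Psi1eps phi0 Z Q alpha alpha0
                (delta phi0 Z Q tau alpha0 alpha)%:E) alpha^'-
       & limf_einf (fun alpha0 => Psi1eps phi0 Z Q alpha alpha0
                (delta phi0 Z Q tau alpha0 alpha)%:E) alpha^'-
           = limf_einf (fun alpha0 => Psi1eps phi0 Z Q alpha0 alpha0
                (delta phi0 Z Q tau alpha0 alpha)%:E) alpha^'-]).
Proof.
have S_inj := bij_inj S_bij.
split; [|split].
- move=> t t01; have slope := Hlim_slope_right (Q := Q) S_inj Lambda_inv
    Z_meas Z_ge0 Z_density t01.
  have Pf := Psi1_fin_num Q S_inj Lambda_inv Z_meas Z_ge0 Z_density t01 t01.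
  split.
  + by exists (fine (Psi1 phi0 Z Q t t)); rewrite fineK.
  + exact/cvg_lim.
  + exact: (Psi1_right S_inj Lambda_inv Z_meas Z_ge0 Z_density t01).
- move=> t tau t01 tau0; split.
  + by apply: (Psi1eps_radius_left (F := fun s _ => s) S_inj Lambda_inv
      Z_meas Z_ge0 Z_density t01 tau0); left.
  + by apply: (Psi1eps_radius_left (F := fun _ t => t) S_inj Lambda_inv
      Z_meas Z_ge0 Z_density t01 tau0); right.
- move=> t tau t01 tau1; split.
  + exact: (slope_left_liminf_ge Q S_inj Lambda_inv Z_meas Z_ge0 Z_density t01).
  + exact: (slope_left_liminf_le Q S_inj Lambda_inv Z_meas Z_ge0 Z_density
      t01 tau1).
  + exact: (Psi1eps_left_liminf Q S_inj Lambda_inv Z_meas Z_ge0 Z_density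
      t01 (lt_trans ltr01 tau1)).
Qed.
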